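(* Let $\mathcal{H}$ be a complex Hilbert space and let $T\in\boldsymbol{B}(\mathcal{H})$. Then the following statements are equivalent: (i) $T$ is normal; (ii) $T$ and $T^*$ are CPD and have the same representing triplets.
   Context: $\boldsymbol{B}(\mathcal{H})$ denotes the bounded linear operators on $\mathcal{H}$; $\mathbb{R}_+=[0,\infty)$; $\mathbb{Z}_+$ is the set of nonnegative integers; $\mathfrak{B}(\mathbb{R}_+)$ is the Borel $\sigma$-algebra of $\mathbb{R}_+$. A semispectral measure is a map $F\colon\mathfrak{B}(\mathbb{R}_+)\to\boldsymbol{B}(\mathcal{H})$ such that $\langle F(\cdot)f,f\rangle$ is a positive measure for every $f\in\mathcal{H}$ (it is not assumed that $F(\mathbb{R}_+)=I$). For a Borel function $f$ that is integrable with respect to $\langle F(\cdot)h,h\rangle$ for all $h\in\mathcal{H}$, $\int_{\mathbb{R}_+}f\,dF$ is the unique operator in $\boldsymbol{B}(\mathcal{H})$ with $\langle\int_{\mathbb{R}_+} f\,dF\,h,h\rangle=\int_{\mathbb{R}_+} f(x)\langle F(dx)h,h\rangle$ for all $h\in\mathcal{H}$. A real sequence $\{\gamma_k\}_{k=0}^{\infty}$ is conditionally positive definite (CPD) if $\sum_{i,j=0}^{k}\gamma_{i+j}\lambda_i\bar\lambda_j\geq0$ for every $k\in\mathbb{Z}_+$ and all $\lambda_0,\dots,\lambda_k\in\mathbb{C}$ with $\sum_{i=0}^k\lambda_i=0$. $T\in\boldsymbol{B}(\mathcal{H})$ is CPD if $\{\|T^kh\|^2\}_{k=0}^\infty$ is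 CPD for every $h\in\mathcal{H}$. It is known that $T$ is CPD if and only if there exist $B,C\in\boldsymbol{B}(\mathcal{H})$ and a compactly supported semispectral measure $F\colon\mathfrak{B}(\mathbb{R}_+)\to\boldsymbol{B}(\mathcal{H})$ such that $B=B^*$, $C\geq0$, $F(\{1\})=0$ and $$T^{*n}T^n=I+nB+n^2C+\int_{\mathbb{R}_+}Q_n\,dF,\quad n\in\mathbb{Z}_+,$$ where $Q_0=Q_1=0$ and $Q_n(x)=\sum_{j=0}^{n-2}(n-j-1)x^j$ for $n\geq2$. The triplet $(B,C,F)$ is then unique and is called the representing triplet of $T$. *)

(* Defs.v *)
From HB Require Import structures.
From mathcomp Require Import all_boot all_order all_algebra.
From mathcomp Require Import all_classical all_reals all_analysis.
From mathcomp Require Import complex.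

Set Implicit Arguments.
Unset Strict Implicit.
Unset Printing Implicit Defensive.
Import Order.TTheory GRing.Theory Num.Theory.
Import numFieldNormedType.Exports.
Local Open Scope complex_scope.
Local Open Scope classical_set_scope.
Local Open Scope ring_scope.

(* A complex Hilbert space is a Banach space over R[i] whose norm is induced  *)
(* by an inner product; the form [dot] is linear in its first argument.       *)
Record hilbertType (R : realType) := HilbertType {
  hilbert_sort :> completeNormedModType R[i] ;
  dot : {dot hilbert_sort for Num.conj} ;
  dotE : forall x : hilbert_sort, dot x x = `|x| ^+ 2 }.

Section Operators.
Variables (R : realType) (H : hilbertType R).

Record bop := Bop {
  bop_fun :> {linear H -> H} ;
  bop_bounded : exists M : R, forall x : H, `|bop_fun x| <= M%:C * `|x| }.

HB.instance Definition _ := gen_eqMixin bop.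
HB.instance Definition _ := gen_choiceMixin bop.

Definition inner (x y : H) : R[i] := dot H x y.

(* The unique S in B(H) with <T x, y> = <x, S y>. By the Riesz representation *)
(* theorem it always exists, so the default value T of [xget] is irrelevant.  *)
Definition adjoint (T : bop) : bop :=
  xget T [set S : bop | forall x y, inner (T x) y = inner x (S y)].

Definition normal_op (T : bop) :=
  forall x, adjoint T (T x) = T (adjoint T x).

Definition selfadjoint (T : bop) := adjoint T = T.

Definition positive_op (T : bop) := forall h, 0 <= inner (T h) h.

Definition cpd_seq (g : nat -> R) :=
  forall (k : nat) (lam : 'I_k.+1 -> R[i]), \sum_i lam i = 0 ->
    0 <= \sum_(i < k.+1) \sum_(j < k.+1) (g (i + j)%N)%:C * lam i * Num.conj (lam j).

(* The norm of H takes its values in R[i]; these are real, hence [Re]. *)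
Definition cpd (T : bop) :=
  forall h, cpd_seq (fun k => complex.Re (`|iter k T h| ^+ 2)).

Definition Rplus : set R := `[0, +oo[.

(* The Borel sigma-algebra of [0, +oo[ is the trace of that of R. *)
Definition borel_Rplus (A : set R) := measurable A /\ A `<=` Rplus.

(* A map F from the Borel sets of [0, +oo[ to B(H) is encoded as a function   *)
(* on all of [set R], of which only the values on [borel_Rplus] are ever      *)
(* used. Likewise a positive measure on [0, +oo[ is given by a measure on R,  *)
(* of which only the trace on [0, +oo[ is used; it is finite because it has   *)
(* to take the values <F A h, h>.                                             *)
Definition scalar_measure (F : set R -> bop) (h : H)
    (mu : {finite_measure set R -> \bar R}) :=
  forall A, borel_Rplus A -> inner (F A h) h = (fine (mu A))%:C.

Definition semispectral (F : set R -> bop) :=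
  forall h, exists mu, scalar_measure F h mu.

Definition compactly_supported (F : set R -> bop) :=
  exists K : set R, [/\ compact K, K `<=` Rplus
    & forall h, F (Rplus `\` K) h = 0].

(* S is the integral of f with respect to F. For each h a measure mu as below *)
(* exists when F is semispectral, and its trace on [0, +oo[ is unique.        *)
Definition is_op_integral (F : set R -> bop) (f : R -> R) (S : bop) :=
  forall h mu, scalar_measure F h mu ->
    mu.-integrable Rplus (EFin \o f) /\
    inner (S h) h = (\int[mu]_(x in Rplus) f x)%:C.

Definition Qpol (n : nat) (x : R) : R :=
  \sum_(0 <= j < n.-1) (n - j - 1)%:R * x ^+ j.

Definition representing_triplet (T B C : bop) (F : set R -> bop) :=
  [/\ selfadjoint B, positive_op C,
      semispectral F /\ compactly_supported F,
      (forall h, F [set 1] h = 0)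
    & forall n : nat, exists2 S : bop, is_op_integral F (Qpol n) S
        & forall x, iter n (adjoint T) (iter n T x)
            = x + n%:R *: B x + (n ^ 2)%:R *: C x + S x].

End Operators.

(* Main.v *)
(** For a normal T put N = T*T = TT*, so that T*^n T^n = N^n. Then |T^k h|^2 = <N^k h, h>,
    whence T and T* are CPD, and both have the triplet (N - I, 0, F), where
    F(A) = (N - I) E(A) (N - I) for the spectral measure E of N: this is the identity
    x^n = 1 + n (x - 1) + (x - 1)^2 Q_n(x) at N. Since <F(.) h, h> has density (x - 1)^2
    with respect to <E(.) h, h>, it has no atom at 1. Conversely, for n = 1 equal triplets
    force T*T = TT*.

    The measures mu_h = <E(.) h, h> solve the Hausdorff moment problem for <N^j h, h> on
    [0, M]: the Bernstein weights 'C(n, k) <N^k (M - N)^(n - k) h, h> / M^n at the points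
    M k / n define positive functionals whose values at x^j tend to <N^j h, h>. A limit of
    these functionals along an ultrafilter is again positive, hence given by a measure
    (Riesz-Markov). The ultrafilter does not depend on h, so that the limits remain
    quadratic forms in h, and by a Dynkin argument so does mu_h(A), which therefore is
    <E(A) h, h> for some operator E(A) (Jordan-von Neumann). *)

Require Import Defs.
From HB Require Import structures.
From mathcomp Require Import all_boot all_order all_algebra.
From mathcomp Require Import all_classical all_reals all_analysis.
From mathcomp Require Import measurable_realfun.
From mathcomp Require Import complex ring lra zify.

Set Implicit Arguments.
Unset Strict Implicit.
Unset Printing Implicit Defensive.
Import Order.TTheory GRing.Theory Num.Theory.
Import numFieldNormedType.Exports.
Local Open Scope complex_scope.
Local Open Scope classical_set_scope.
Local Open Scope ring_scope.

(** * Operators and quadratic forms on a Hilbert space *)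

Lemma nonneg_quadratic_discriminant (R : realFieldType) (p q r : R) : 0 <= r ->
  (forall t, 0 <= p + t * q *+ 2 + t ^+ 2 * r) -> q ^+ 2 <= p * r.
Proof.
rewrite le_eqVlt => /predU1P[<- nonneg|r_gt0 nonneg].
  rewrite mulr0; have [->|q_neq0] := eqVneq q 0; first by rewrite expr0n.
  have := nonneg (- (p + 1) / (q *+ 2)).
  by rewrite mulr0 addr0 -mulrnAr mulrVK ?unitfE ?mulrn_eq0//=; lra.
have := nonneg (- q / r).
suff -> : p + - q / r * q *+ 2 + (- q / r) ^+ 2 * r = (p * r - q ^+ 2) / r.
  by rewrite pmulr_lge0 ?invr_gt0// subr_ge0.
by field; rewrite gt_eqF.
Qed.

Section InnerProduct.
Variables (R : realType) (H : hilbertType R).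
Implicit Types (x y z : H) (a : R) (l : R[i]).

Lemma innerDl x y z : inner (x + y) z = inner x z + inner y z.
Proof. exact: linearDl. Qed.

Lemma innerDr x y z : inner z (x + y) = inner z x + inner z y.
Proof. exact: linearDr. Qed.

Lemma innerNl x y : inner (- x) y = - inner x y.
Proof. exact: linearNl. Qed.

Lemma innerNr x y : inner x (- y) = - inner x y.
Proof. exact: linearNr. Qed.

Lemma innerZl l x y : inner (l *: x) y = l * inner x y.
Proof. exact: linearZl_LR. Qed.

Lemma innerZr l x y : inner x (l *: y) = Num.conj l * inner x y.
Proof. exact: linearZr_LR. Qed.

Lemma inner_suml n (F : 'I_n -> H) y :
  inner (\sum_i F i) y = \sum_i inner (F i) y.
Proof. exact: linear_sumlz. Qed.

Lemma inner_sumr n (F : 'I_n -> H) y :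
  inner y (\sum_i F i) = \sum_i inner y (F i).
Proof. exact: linear_sumr. Qed.

Lemma inner_conj x y : inner x y = Num.conj (inner y x).
Proof. by rewrite /inner (hermC (dot H) x y) expr0 mul1r. Qed.

Lemma inner_norm x : inner x x = `|x| ^+ 2.
Proof. exact: dotE. Qed.

Definition rdot x y : R := complex.Re (inner x y).

Lemma rdotC x y : rdot x y = rdot y x.
Proof. by rewrite /rdot inner_conj; case: (inner y x). Qed.

Lemma rdotDl x y z : rdot (x + y) z = rdot x z + rdot y z.
Proof. by rewrite /rdot innerDl; case: (inner x z); case: (inner y z). Qed.

Lemma rdotDr x y z : rdot z (x + y) = rdot z x + rdot z y.
Proof. by rewrite rdotC rdotDl !(rdotC z). Qed.

Lemma rdotNl x y : rdot (- x) y = - rdot x y.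
Proof. by rewrite /rdot innerNl; case: (inner x y). Qed.

Lemma rdotNr x y : rdot x (- y) = - rdot x y.
Proof. by rewrite rdotC rdotNl rdotC. Qed.

Lemma rdotBl x y z : rdot (x - y) z = rdot x z - rdot y z.
Proof. by rewrite rdotDl rdotNl. Qed.

Lemma rdotZl a x y : rdot (a%:C *: x) y = a * rdot x y.
Proof.
by rewrite /rdot innerZl; case: (inner x y) => u v /=; rewrite mul0r subr0.
Qed.

Lemma rdotZr a x y : rdot x (a%:C *: y) = a * rdot x y.
Proof. by rewrite rdotC rdotZl rdotC. Qed.

Lemma rdotiE x y : rdot ('i *: x) y = - complex.Im (inner x y).
Proof.
by rewrite /rdot innerZl; case: (inner x y) => u v /=; rewrite mul0r mul1r sub0r.
Qed.

Lemma rdotil x y : rdot ('i *: x) y = - rdot x ('i *: y).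
Proof.
by rewrite [in RHS]rdotC !rdotiE inner_conj; case: (inner y x) => u v; rewrite /= opprK.
Qed.

Lemma inner_rdot x y : inner x y = rdot x y +i* - rdot ('i *: x) y.
Proof. by rewrite rdotiE opprK /rdot; case: (inner x y). Qed.

Lemma norm_rdot x : `|x| ^+ 2 = (rdot x x)%:C.
Proof.
have : 0 <= inner x x by rewrite inner_norm exprn_ge0.
by rewrite /rdot -inner_norm; case: (inner x x) => u v; rewrite lecE /= => /andP[/eqP->].
Qed.

Lemma rdot_ge0 x : 0 <= rdot x x.
Proof. by rewrite -lecR -norm_rdot exprn_ge0. Qed.

Lemma rdot_eq0 x : rdot x x = 0 -> x = 0.
Proof.
by move=> x0; apply/eqP; rewrite -normr_eq0 -sqrf_eq0 norm_rdot x0.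
Qed.

Lemma rdot_inj x y : (forall z, rdot x z = rdot y z) -> x = y.
Proof. by move=> xy; apply/subr0_eq/rdot_eq0; rewrite rdotBl xy subrr. Qed.

Lemma rdot_Cauchy_Schwarz x y : rdot x y ^+ 2 <= rdot x x * rdot y y.
Proof.
apply: nonneg_quadratic_discriminant (rdot_ge0 y) _ => t; have := rdot_ge0 (x + t%:C *: y).
by rewrite !(rdotDl, rdotDr, rdotZl, rdotZr) (rdotC y x); lra.
Qed.

Lemma norm_le_rdot a x y : 0 <= a ->
  `|x| <= a%:C * `|y| <-> rdot x x <= a ^+ 2 * rdot y y.
Proof.
move=> a0; rewrite -(@ler_pXn2r _ 2)// ?nnegrE ?mulr_ge0 ?lecR//.
by rewrite exprMn !norm_rdot -rmorphXn -rmorphM/= lecR.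
Qed.

Lemma norm_lt_rdot a x : 0 <= a -> (`|x| < a%:C) = (rdot x x < a ^+ 2).
Proof.
move=> a0; rewrite -(@ltr_pXn2r _ 2)// ?nnegrE ?lecR//.
by rewrite norm_rdot -rmorphXn/= ltcR.
Qed.

Lemma rdot_le_norm x y : `|rdot x y|%:C <= `|x| * `|y|.
Proof.
rewrite -(@ler_pXn2r _ 2)// ?nnegrE ?mulr_ge0 ?lecR//.
by rewrite exprMn !norm_rdot -rmorphXn -rmorphM/= lecR real_normK ?num_real// rdot_Cauchy_Schwarz.
Qed.

Lemma cvg_rdotl (I : Type) (F : set_system I) {FF : Filter F} (u : I -> H) x y :
  u @ F --> x -> rdot (u i) y @[i --> F] --> rdot x y.
Proof.
move=> ux; apply/cvgrPdist_lt => e e0.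
have y1 : 0 < `|y| + 1 :> R[i] by rewrite ltr_wpDl.
have e1 : 0 < e%:C / (`|y| + 1) by rewrite divr_gt0// ltcR.
near=> i; rewrite -rdotBl -ltcR; apply: le_lt_trans (rdot_le_norm _ _) _.
have : `|x - u i| < e%:C / (`|y| + 1) by near: i; move/cvgrPdist_lt : ux; exact.
rewrite ltr_pdivlMr//; apply: le_lt_trans.
by rewrite ler_wpM2l// lerDl.
Unshelve. all: by end_near. Qed.

Lemma cauchy_rdot_harmonic (u : nat -> H) :
  (forall n m, rdot (u n - u m) (u n - u m) <= (n.+1%:R^-1 + m.+1%:R^-1) *+ 2) ->
  cauchy (u @ \oo).
Proof.
move=> u_dist; apply/cauchy_ballP => -[e ei]; rewrite ltcE/= => /andP[/eqP -> e0].
have e4 : 0 < e ^+ 2 / 4%:R by rewrite divr_gt0 ?exprn_gt0.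
have [N _ tail] := near_infty_natSinv_lt (PosNum e4).
exists (u @` [set n | (N <= n)%N], u @` [set n | (N <= n)%N]) => /=.
  by split; exists N => // n /= Nn; exists n.
case=> _ _ /= [[n /tail /= n_lt <-] [m /tail /= m_lt <-]].
rewrite -ball_normE /= norm_lt_rdot ?ltW//; apply: le_lt_trans (u_dist n m) _.
by move: (n.+1%:R^-1) (m.+1%:R^-1) n_lt m_lt => a b; lra.
Qed.

End InnerProduct.

Section RieszRepresentation.
Variables (R : realType) (H : hilbertType R) (phi : H -> R) (K : R).
Hypotheses (phiD : {morph phi : x y / x + y})
  (phiZ : forall (a : R) x, phi (a%:C *: x) = a * phi x)
  (K_ge0 : 0 <= K) (phi_bound : forall x, phi x ^+ 2 <= K * rdot x x).
Implicit Types (x y v : H).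

Let energy x := rdot x x - phi x *+ 2.

Let energy_min := inf (range energy).

Let energy_lbound x : - K <= energy x.
Proof.
rewrite /energy; have := phi_bound x; have := rdot_ge0 x; have := K_ge0.
move: (rdot x x) (phi x) => r p K0 r0 prK; rewrite leNgt; apply/negP => lt_energy.
have : 0 < (p *+ 2 - (K + r)) * (p *+ 2 + (K + r)) by apply: mulr_gt0; lra.
by have := sqr_ge0 (K - r); lra.
Qed.

Let has_inf_energy : has_inf (range energy).
Proof.
by split; [exists (energy 0), 0 | exists (- K) => _ [x _ <-]; exact: energy_lbound].
Qed.

Let energy_min_le x : energy_min <= energy x.
Proof. by apply: ge_inf; [case: has_inf_energy | exists x]. Qed.

Let energy_dist x y :
  rdot (x - y) (x - y) <= (energy x - energy_min + (energy y - energy_min)) *+ 2.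
Proof.
have := energy_min_le ((2%:R^-1)%:C *: (x + y)).
rewrite /energy phiZ phiD !(rdotZl, rdotZr, rdotDl, rdotDr, rdotNl, rdotNr) (rdotC y x).
lra.
Qed.

Let energy_derivative v x :
  (rdot v x - phi x) ^+ 2 <= (energy v - energy_min) * rdot x x.
Proof.
apply: nonneg_quadratic_discriminant (rdot_ge0 x) _ => t.
have := energy_min_le (v + t%:C *: x).
rewrite /energy phiD phiZ !(rdotDl, rdotDr, rdotZl, rdotZr) (rdotC x); lra.
Qed.

(* A minimising sequence of the energy |x|^2 - 2 phi x is Cauchy; at its limit the
   derivative of the energy vanishes. *)
Theorem riesz_representation : exists v, forall x, phi x = rdot v x.
Proof.
have /choice[v v_min] (n : nat) : exists v, energy v < energy_min + n.+1%:R^-1.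
  have n0 : 0 < n.+1%:R^-1 :> R by rewrite invr_gt0.
  by have [_ [x _ <-] ?] := inf_adherent n0 has_inf_energy; exists x.
have /cauchy_cvg v_cvg : cauchy (v @ \oo).
  apply: cauchy_rdot_harmonic => n m; apply: le_trans (energy_dist _ _) _.
  by rewrite lerMn2r/= lerD// lerBlDl ltW.
exists (lim (v @ \oo)) => x.
have gap_cvg : n.+1%:R^-1 * rdot x x - (rdot (v n) x - phi x) ^+ 2 @[n --> \oo]
    --> 0 * rdot x x - (rdot (lim (v @ \oo)) x - phi x) ^+ 2.
  have vx_cvg : rdot (v n) x - phi x @[n --> \oo] --> rdot (lim (v @ \oo)) x - phi x.
    by apply: cvgB; [exact: cvg_rdotl | exact: cvg_cst].
  apply: cvgB; first by apply: cvgMr_tmp; exact: cvg_harmonic.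
  exact: (cvgM vx_cvg vx_cvg).
have : 0 <= 0 * rdot x x - (rdot (lim (v @ \oo)) x - phi x) ^+ 2.
  apply: (cvgr_to_ge gap_cvg); apply: nearW => n; rewrite subr_ge0.
  by apply: le_trans (energy_derivative _ _) _; rewrite ler_wpM2r ?rdot_ge0// lerBlDl ltW.
rewrite mul0r sub0r oppr_ge0 => sqr_le0; apply/esym/eqP.
by rewrite -subr_eq0 -sqrf_eq0 eq_le sqr_le0 sqr_ge0.
Qed.

End RieszRepresentation.

Section Operators.
Variables (R : realType) (H : hilbertType R).
Implicit Types (S T : bop H) (x y : H) (a : R).

Lemma bop_rdot_bounded S :
  exists2 K : R, 0 <= K & forall x, rdot (S x) (S x) <= K ^+ 2 * rdot x x.
Proof.
have [M SM] := bop_bounded S; exists `|M| => // x.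
apply/norm_le_rdot => //; apply: le_trans (SM x) _.
by rewrite ler_wpM2r// lecR ler_norm.
Qed.

Lemma scaler_complexE (l : R[i]) x :
  l *: x = (complex.Re l)%:C *: x + (complex.Im l)%:C *: ('i *: x).
Proof. by rewrite scalerA -scalerDl [in RHS]mulrC -complexE. Qed.

Lemma complex_linear (f : H -> H) : {morph f : x y / x + y} ->
  (forall a x, f (a%:C *: x) = a%:C *: f x) -> (forall x, f ('i *: x) = 'i *: f x) ->
  linear f.
Proof.
move=> fD fZ fi l x y; rewrite fD; congr (_ + _).
by rewrite scaler_complexE fD !fZ fi -scaler_complexE.
Qed.

Lemma bop_of_form (b : H -> H -> R) (K : R) : 0 <= K ->
  (forall x y z, b (x + y) z = b x z + b y z) ->
  (forall a x y, b (a%:C *: x) y = a * b x y) ->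
  (forall x y z, b x (y + z) = b x y + b x z) ->
  (forall a x y, b x (a%:C *: y) = a * b x y) ->
  (forall x y, b ('i *: x) y = - b x ('i *: y)) ->
  (forall x y, b x y ^+ 2 <= K ^+ 2 * rdot x x * rdot y y) ->
  exists S : bop H, forall x y, b x y = rdot (S x) y.
Proof.
move=> K_ge0 bDl bZl bDr bZr bi b_bound.
have /choice[f fE] x : exists v, forall y, b x y = rdot v y.
  by apply: riesz_representation (b_bound x) => //; rewrite mulr_ge0 ?sqr_ge0 ?rdot_ge0.
have f_linear : linear f.
  apply: complex_linear => [x y|a x|x]; apply: rdot_inj => z.
  - by rewrite rdotDl -!fE bDl.
  - by rewrite rdotZl -!fE bZl.
  - by rewrite rdotil -!fE bi.
have f_bounded : exists M : R, forall x, `|f x| <= M%:C * `|x|.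
  exists K => x; apply/norm_le_rdot => //; have := b_bound x (f x); rewrite fE.
  have [->|fx0] := eqVneq (rdot (f x) (f x)) 0.
    by rewrite mulr_ge0 ?sqr_ge0 ?rdot_ge0.
  by rewrite expr2 ler_pM2r// lt0r fx0 rdot_ge0.
pose L : {linear H -> H} := HB.pack f (GRing.isLinear.Build _ _ _ _ f f_linear).
by exists (@Bop R H L f_bounded).
Qed.

Lemma adjoint_exists S :
  exists T : bop H, forall x y, inner (S x) y = inner x (T y).
Proof.
have [K K_ge0 SK] := bop_rdot_bounded S.
have [||||||T TE] := @bop_of_form (fun y x => rdot (S x) y) K K_ge0.
- by move=> x y z; rewrite rdotDr.
- by move=> a x y; rewrite rdotZr.
- by move=> x y z; rewrite linearD rdotDl.
- by move=> a x y; rewrite linearZ rdotZl.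
- by move=> x y; rewrite linearZ rdotil opprK.
- move=> x y; apply: le_trans (rdot_Cauchy_Schwarz _ _) _.
  by rewrite mulrAC ler_wpM2r ?rdot_ge0.
exists T => x y; rewrite !inner_rdot -linearZ !TE.
by rewrite !(rdotC (T y)).
Qed.

Lemma inner_adjoint S x y : inner (S x) y = inner x (adjoint S y).
Proof.
have [T TP] := adjoint_exists S.
by rewrite /adjoint; case: xgetP => [T' _ -> //|/(_ T)]; case.
Qed.

Lemma inner_adjointl S x y : inner (adjoint S x) y = inner x (S y).
Proof. by rewrite inner_conj -inner_adjoint -inner_conj. Qed.

Lemma bop_ext S T : S =1 T -> S = T.
Proof.
case: S T => f f_bounded [g g_bounded] /= fg.
have {}fg : f = g.
  case: f g fg {f_bounded g_bounded} => f [[fD] [fZ]] [g [[gD] [gZ]]] /= /funext fg.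
  by move: fD fZ gD gZ; rewrite fg => fD fZ gD gZ; congr GRing.Linear.Pack;
    rewrite (Prop_irrelevance fD gD) (Prop_irrelevance fZ gZ).
by move: f_bounded; rewrite fg => f_bounded; rewrite (Prop_irrelevance f_bounded g_bounded).
Qed.

Lemma adjoint_unique S T : (forall x y, inner (S x) y = inner x (T y)) -> adjoint S = T.
Proof.
move=> ST; apply: bop_ext => y; apply: rdot_inj => x.
by rewrite rdotC (rdotC _ x) /rdot -inner_adjoint ST.
Qed.

Lemma adjointK S : adjoint (adjoint S) = S.
Proof. by apply: adjoint_unique => x y; rewrite inner_adjointl. Qed.

Lemma quad_eq0 (f : {linear H -> H}) :
  (forall x, inner (f x) x = 0) -> forall x, f x = 0.
Proof.
move=> f0 x; apply: rdot_eq0; rewrite /rdot; set y := f x.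
have := f0 (x + y); rewrite linearD innerDl !innerDr !f0 add0r addr0 => sum0.
have := f0 (x + 'i *: y); rewrite linearD linearZ innerDl !innerDr -linearZ !f0.
rewrite add0r addr0 linearZ innerZl innerZr -/y.
case: (inner y y) (inner (f y) x) sum0 => [u v] [s t] /= /eqP + /eqP.
by rewrite !eq_complex/= => /andP[/eqP ? _] /andP[_ /eqP ?]; lra.
Qed.

Lemma quad_inj S T : (forall x, inner (S x) x = inner (T x) x) -> S =1 T.
Proof.
move=> ST x; apply: subr0_eq.
by apply: (quad_eq0 (f := S \- T)) => y; rewrite /= innerDl innerNl ST subrr.
Qed.

Lemma bop_zero_bounded : exists M : R, forall x : H, `|(\0 : H -> H) x| <= M%:C * `|x|.
Proof. by exists 0 => x; rewrite /= normr0 mul0r. Qed.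

Definition bop_zero : bop H := Bop (bop_fun := \0) bop_zero_bounded.

Lemma bop_id_bounded : exists M : R, forall x : H, `|idfun x| <= M%:C * `|x|.
Proof. by exists 1 => x; rewrite mul1r. Qed.

Definition bop_id : bop H := Bop (bop_fun := idfun) bop_id_bounded.

Lemma bop_comp_bounded S T : exists M : R, forall x, `|(S \o T) x| <= M%:C * `|x|.
Proof.
have [K SK] := bop_bounded S; have [L TL] := bop_bounded T.
exists (`|K| * L) => x; rewrite rmorphM/= -mulrA.
apply: le_trans (SK _) _; apply: (@le_trans _ _ (`|K|%:C * `|T x|)).
  by rewrite ler_wpM2r// lecR ler_norm.
by rewrite ler_wpM2l// lecR.
Qed.

Definition bop_comp S T : bop H := Bop (bop_fun := S \o T) (bop_comp_bounded S T).

Lemma bop_sub_bounded S T : exists M : R, forall x, `|(S \- T) x| <= M%:C * `|x|.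
Proof.
have [K SK] := bop_bounded S; have [L TL] := bop_bounded T.
by exists (K + L) => x; rewrite rmorphD mulrDl; apply: le_trans (ler_normB _ _) (lerD _ _).
Qed.

Definition bop_sub S T : bop H := Bop (bop_fun := S \- T) (bop_sub_bounded S T).

Lemma bop_scale_bounded a S : exists M : R, forall x, `|(a%:C \*: S) x| <= M%:C * `|x|.
Proof.
have [K SK] := bop_bounded S.
exists (`|a| * K) => x; rewrite /= normrZ rmorphM/= -mulrA normc_def/= expr0n/= addr0 sqrtr_sqr.
by rewrite ler_wpM2l// lecR.
Qed.

Definition bop_scale a S : bop H := Bop (bop_fun := a%:C \*: S) (bop_scale_bounded a S).

Lemma selfadjoint_bop_id : selfadjoint bop_id.
Proof. exact: adjoint_unique. Qed.

Lemma selfadjoint_bop_sub S T : selfadjoint S -> selfadjoint T -> selfadjoint (bop_sub S T).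
Proof.
move=> S_sa T_sa; apply: adjoint_unique => x y /=.
by rewrite innerDl innerDr innerNl innerNr !inner_adjoint S_sa T_sa.
Qed.

Definition bop_iter n S : bop H := iter n (bop_comp S) bop_id.

Lemma bop_iterE n S x : bop_iter n S x = iter n S x.
Proof. by elim: n => //= n <-. Qed.

End Operators.
Arguments bop_id {R H}.
Arguments bop_zero {R H}.

Section QuadraticForms.
Variables (R : realType) (H : hilbertType R).
Implicit Types (q : H -> R) (S : bop H) (x y z : H) (a : R).

(* Only finitely many values of q occur in each condition, so that the notion passes to
   pointwise limits. *)
Definition quadratic_form q :=
  [/\ forall x y, q (x + y) + q (x - y) = 2 * (q x + q y),
      forall a x, q (a%:C *: x) = a ^+ 2 * q x
    & forall x, q ('i *: x) = q x].

Lemma quadratic_form_rdot S : quadratic_form (fun x => rdot (S x) x).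
Proof.
split=> [x y|a x|x]; rewrite ?linearZ/=.
- by rewrite linearB linearD !(rdotDl, rdotDr, rdotNl, rdotNr); lra.
- by rewrite rdotZl rdotZr mulrA.
- by rewrite rdotil scalerA -expr2 sqr_i scaleN1r rdotNr opprK.
Qed.

Lemma quadratic_formD q q' : quadratic_form q -> quadratic_form q' ->
  quadratic_form (fun x => q x + q' x).
Proof.
move=> [qD qZ qi] [qD' qZ' qi']; split=> [x y|a x|x].
- by rewrite addrACA qD qD'; lra.
- by rewrite qZ qZ' mulrDr.
- by rewrite qi qi'.
Qed.

Lemma quadratic_formZ a q : quadratic_form q -> quadratic_form (fun x => a * q x).
Proof.
move=> [qD qZ qi]; split=> [x y|b x|x].
- by rewrite -mulrDr qD; lra.
- by rewrite qZ mulrCA.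
- by rewrite qi.
Qed.

Lemma quadratic_form_sum n (q_ : 'I_n -> H -> R) :
  (forall i, quadratic_form (q_ i)) -> quadratic_form (fun x => \sum_(i < n) q_ i x).
Proof.
move=> q_quad; elim: (index_enum _) => [|i r IH].
  by under eq_fun do rewrite big_nil; split=> *; rewrite ?addr0 ?mulr0.
by under eq_fun do rewrite big_cons; exact: quadratic_formD.
Qed.

Lemma quadratic_form_lim (I : Type) (F : set_system I) (q_ : I -> H -> R) q :
  ProperFilter F -> (forall i, quadratic_form (q_ i)) ->
  (forall x, q_ i x @[i --> F] --> q x) -> quadratic_form q.
Proof.
move=> FF q_quad q_cvg; have lim_eq (u v : I -> R) a b :
    u =1 v -> u @ F --> a -> v @ F --> b -> a = b.
  by move=> /funext -> ua vb; exact: cvg_unique ua vb.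
split=> [x y|a x|x].
- apply: lim_eq (cvgD (q_cvg _) (q_cvg _)) (cvgMl_tmp (cvgD (q_cvg _) (q_cvg _))) => i.
  by case: (q_quad i) => qD _ _; exact: qD.
- apply: lim_eq (q_cvg _) (cvgMl_tmp (q_cvg _)) => i.
  by case: (q_quad i) => _ qZ _; exact: qZ.
- apply: lim_eq (q_cvg _) (q_cvg _) => i.
  by case: (q_quad i) => _ _ qi; exact: qi.
Qed.

End QuadraticForms.

Lemma natrM_bounded_le0 (R : archiRealFieldType) (y C : R) :
  (forall k : nat, k%:R * y <= C) -> y <= 0.
Proof.
move=> y_bound; rewrite leNgt; apply/negP => y0.
have := truncnS_gt (C / y); rewrite ltr_pdivrMr// ltNge => /negP; apply.
exact: y_bound.
Qed.

Lemma additive_bounded_linear (R : archiRealFieldType) (f : R -> R) (C : R) :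
  {morph f : s t / s + t} -> (forall t, 0 <= t <= 1 -> `|f t| <= C) ->
  forall t, f t = t * f 1.
Proof.
move=> fD f_bound t.
have fn n s : f (s *+ n) = f s *+ n.
  elim: n => [|n IH]; last by rewrite !mulrSr fD IH.
  by rewrite !mulr0n; apply: (addrI (f 0)); rewrite -fD !addr0.
pose g s := f s - s * f 1.
have gD s u : g (s + u) = g s + g u by rewrite /g fD; ring.
have gn n s : g (s *+ n) = g s *+ n by rewrite /g fn; ring.
have g1 n : g n%:R = 0 by rewrite gn /g mul1r subrr mul0rn.
have g_periodic s n : g (s + n%:R) = g s by rewrite gD g1 addr0.
have g0 : g 0 = 0 := g1 0%N.
have gN s : g (- s) = - g s by apply: (addrI (g s)); rewrite -gD !subrr g0.
have g_bound s : `|g s| <= C + `|f 1|.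
  wlog s_ge0 : s / 0 <= s => [bound_ge0|].
    have [/bound_ge0//|s_lt0] := leP 0 s.
    by rewrite -normrN -gN bound_ge0// oppr_ge0 ltW.
  have /andP[trunc_le lt_trunc] := truncn_itv s_ge0.
  set r := s - (Num.truncn s)%:R.
  have r01 : 0 <= r <= 1 by move: lt_trunc; rewrite -natr1 /r => ?; apply/andP; split; lra.
  rewrite -(subrK (Num.truncn s)%:R s) g_periodic -/r (le_trans (ler_normB _ _))//.
  rewrite lerD ?f_bound// normrM ler_piMl//; case/andP: r01 => r0 r1.
  by rewrite ger0_norm.
apply/subr0_eq/eqP; rewrite -normr_eq0 eq_le normr_ge0 andbT.
apply: (@natrM_bounded_le0 _ _ (C + `|f 1|)) => k.
by rewrite mulr_natl -normrMn -/(g t) -gn.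
Qed.

Section JordanVonNeumann.
Variables (R : realType) (H : hilbertType R) (q : H -> R) (K : R).
Hypotheses (q_quad : quadratic_form q) (q_bound : forall x, 0 <= q x <= K * rdot x x).
Implicit Types (x y z : H) (a : R).

Definition polar x y := (q (x + y) - q (x - y)) / 4%:R.

Let q_ge0 x : 0 <= q x. Proof. by case/andP: (q_bound x). Qed.

Let qZ a x : q (a%:C *: x) = a ^+ 2 * q x. Proof. by case: q_quad. Qed.

Let qN x : q (- x) = q x.
Proof. by have := qZ (-1) x; rewrite sqrrN expr1n mul1r rmorphN1 scaleN1r. Qed.

Lemma polarC x y : polar x y = polar y x.
Proof. by rewrite /polar (addrC x y) -(qN (y - x)) opprB. Qed.

Let q_sum3 x y z : q (x + y + z) = q (x + y) + q (x + z) + q (y + z) - q x - q y - q z.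
Proof.
case: q_quad => qD _ _.
have := qD (x + z) y; have := qD (y + z) x; have := qD z (x - y); have := qD x y.
rewrite [x + z + y]addrAC [y + z + x]addrC [x + (y + z)]addrA.
rewrite [z + (x - y)]addrCA [x + (z - y)]addrA opprB [z + (y - x)]addrCA [y + (z - x)]addrA.
lra.
Qed.

Lemma polarDl x y z : polar (x + y) z = polar x z + polar y z.
Proof. by rewrite /polar !q_sum3 qN; lra. Qed.

Lemma polarZl a x y : polar (a%:C *: x) y = a * polar x y.
Proof.
rewrite (@additive_bounded_linear _ (fun t => polar (t%:C *: x) y) (q x + q y)).
- by rewrite scale1r.
- by move=> s t; rewrite rmorphD scalerDl polarDl.
move=> t /andP[t0 t1]; case: q_quad => /(_ (t%:C *: x) y) qD _ _.
have := q_ge0 (t%:C *: x + y); have := q_ge0 (t%:C *: x - y).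
have : t ^+ 2 * q x <= q x by rewrite ler_piMl// expr_le1.
have := q_ge0 x; have := q_ge0 y; rewrite ler_norml /polar; move: qD; rewrite qZ.
by move=> *; apply/andP; split; lra.
Qed.

Lemma polarxx x : polar x x = q x.
Proof.
rewrite /polar subrr -mulr2n -scaler_nat -(rmorph_nat (real_complex R)) qZ.
have -> : q 0 = 0 by have := qZ 0 x; rewrite scale0r expr0n mul0r.
by field.
Qed.

Lemma polaril x y : polar ('i *: x) y = - polar x ('i *: y).
Proof.
have polar_i u v : polar ('i *: u) ('i *: v) = polar u v.
  by case: q_quad => _ _ qi; rewrite /polar -scalerDr -scalerBr !qi.
rewrite -polar_i scalerA -expr2 sqr_i.
by have := polarZl (-1) x ('i *: y); rewrite rmorphN1 mulN1r.
Qed.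

Lemma polar_Cauchy_Schwarz x y : polar x y ^+ 2 <= q x * q y.
Proof.
apply: nonneg_quadratic_discriminant => // t; have := q_ge0 (x + t%:C *: y).
rewrite -!polarxx !(polarDl, polarZl) !(polarC _ (_ + _)) !(polarDl, polarZl).
by rewrite (polarC y x); lra.
Qed.

Theorem jordan_von_neumann : exists S : bop H, forall x, inner (S x) x = (q x)%:C.
Proof.
have [|||||||S SE] := @bop_of_form _ H polar `|K|.
- by [].
- exact: polarDl.
- exact: polarZl.
- by move=> x y z; rewrite !(polarC x) polarDl.
- by move=> a x y; rewrite !(polarC x) polarZl.
- exact: polaril.
- move=> x y; apply: le_trans (polar_Cauchy_Schwarz x y) _.
  have /andP[qx0 qxK] := q_bound x; have /andP[qy0 qyK] := q_bound y.
  rewrite real_normK ?num_real// [leRHS](_ : _ = K * rdot x x * (K * rdot y y)); last by ring.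
  exact: ler_pM.
exists S => x; rewrite inner_rdot -linearZ -!SE polarxx.
suff -> : polar ('i *: x) x = 0 by rewrite oppr0.
by have := polaril x x; rewrite (polarC x); lra.
Qed.

End JordanVonNeumann.

(** * Positive functionals on an interval *)

Section CarriedMeasures.
Variables (d : measure_display) (T : measurableType d) (R : realType).
Variables (mu : {measure set T -> \bar R}) (K : set T).
Implicit Types (A D : set T) (g : T -> R).

Definition carried_by := mu (~` K) = 0%E.

Hypotheses (mK : measurable K) (mu_carried : carried_by).

Lemma carried_subset0 A : measurable A -> A `<=` ~` K -> mu A = 0%E.
Proof. by move=> mA AK; apply: (subset_measure0 _ _ AK) => //; exact: measurableC. Qed.

Lemma carried_setI A : measurable A -> mu (A `&` K) = mu A.
Proof.
move=> mA; rewrite [RHS](measureDI mu mA mK) [X in (X + _)%E]carried_subset0.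
- by rewrite add0e.
- exact: measurableD.
- by move=> x [].
Qed.

Lemma carried_Rintegral_indic A : measurable A -> \int[mu]_(x in K) \1_A x = fine (mu A).
Proof. by move=> mA; rewrite /Rintegral integral_indic//= carried_setI. Qed.

Lemma carried_Rintegral D g : measurable D -> K `<=` D -> measurable_fun D g ->
  mu.-integrable K (EFin \o g) ->
  mu.-integrable D (EFin \o g) /\ \int[mu]_(x in D) g x = \int[mu]_(x in K) g x.
Proof.
move=> mD KD mg; have mDK : measurable (D `\` K) by exact: measurableD.
have DK0 : mu (D `\` K) = 0%E by apply: carried_subset0 => // x [].
rewrite -[in X in X -> _](setIidr KD) -setDD => ig.
have igD : mu.-integrable D (EFin \o g).
  by apply/(negligible_integrable mDK) => //; exact/measurable_EFinP.
by split=> //; rewrite /Rintegral (negligible_integral mDK)// setDD (setIidr KD).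
Qed.

End CarriedMeasures.

Lemma eq_measure_Rintegral (d : measure_display) (T : measurableType d) (R : realType)
    (mu nu : {measure set T -> \bar R}) (D : set T) (g : T -> R) :
  (forall A, measurable A -> A `<=` D -> nu A = mu A) ->
  mu.-integrable D (EFin \o g) ->
  nu.-integrable D (EFin \o g) /\ \int[nu]_(x in D) g x = \int[mu]_(x in D) g x.
Proof.
move=> numu /integrableP[mg ig]; split; last by rewrite /Rintegral (eq_measure_integral mu).
by apply/integrableP; split=> //; rewrite (eq_measure_integral mu).
Qed.

Section RightLimit.
Variables (R : realType) (f : R -> R).
Hypothesis f_nd : {homo f : s t / s <= t}.
Implicit Types s t : R.

Definition right_lim t := lim (f u @[u --> t^'+]).

Lemma cvg_right_lim t : f u @[u --> t^'+] --> right_lim t.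
Proof.
apply: nondecreasing_at_right_is_cvgr; apply: nearW => s; first exact: in2W f_nd.
by exists (f t) => _ [u /= /[!in_itv]/= /andP[/ltW tu _] <-]; exact: f_nd.
Qed.

Lemma le_right_lim t : f t <= right_lim t.
Proof.
apply: (cvgr_to_ge (@cvg_right_lim t)); near=> u.
by apply: f_nd; rewrite ltW//; near: u; exact: nbhs_right_gt.
Unshelve. all: by end_near. Qed.

Lemma right_lim_le s t : s < t -> right_lim s <= f t.
Proof.
move=> st; apply: (cvgr_to_le (@cvg_right_lim s)); near=> u.
by apply: f_nd; rewrite ltW//; near: u; exact: nbhs_right_lt.
Unshelve. all: by end_near. Qed.

Lemma right_lim_nd : {homo right_lim : s t / s <= t}.
Proof.
move=> s t; rewrite le_eqVlt => /predU1P[->//|st].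
exact: le_trans (right_lim_le st) (le_right_lim t).
Qed.

Lemma right_lim_right_continuous : right_continuous right_lim.
Proof.
move=> t; apply/cvgrPdist_le => e e0.
have /filter_ex[u [tu u_close]] :
    \forall u \near t^'+, t < u /\ `|right_lim t - f u| <= e.
  near=> u; split; near: u; first exact: nbhs_right_gt.
  by move/cvgrPdist_le : (@cvg_right_lim t); exact.
near=> s; have ts : t < s by near: s; exact: nbhs_right_gt.
have su : s < u by near: s; exact: nbhs_right_lt.
have := right_lim_nd (ltW ts); have := right_lim_le su.
by move: u_close; rewrite !ler_distl; lra.
Unshelve. all: by end_near. Qed.

End RightLimit.

Lemma lebesgue_stieltjes_itvoc (R : realType) (F : cumulative R R) s t : s <= t ->
  lebesgue_stieltjes_measure F `]s, t]%classic = (F t - F s)%:E.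
Proof.
move=> st; rewrite /lebesgue_stieltjes_measure /measure_extension/=.
by rewrite measurable_mu_extE/= ?wlength_itv_bnd//; exact: is_ocitv.
Qed.

Section CumulativeMeasure.
Variables (R : realType) (F : R -> R) (a b : R).
Hypotheses (F_nd : {homo F : s t / s <= t}) (F_rc : right_continuous F)
  (F_lt : forall t, t < a -> F t = 0) (F_ge : forall t, b <= t -> F t = F b).

Theorem cumulative_measure : exists mu : {finite_measure set R -> \bar R},
  carried_by mu `[a, b] /\ forall t, mu `]-oo, t]%classic = (F t)%:E.
Proof.
pose G : cumulative R R := HB.pack F (isCumulative.Build R _ R F F_nd F_rc).
pose ls0 := lebesgue_stieltjes_measure G.
(* lebesgue_stieltjes_measure lives on a copy of R with another measure display. *)
pose ls : {measure set R -> \bar R} := HB.pack (ls0 : set R -> \bar R)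
  (isMeasure.Build _ R R ls0 (measure0 ls0) (measure_ge0 ls0)
    (@measure_semi_sigma_additive _ _ _ ls0)).
pose c := a - 1; have ca : c < a by rewrite ltrBlDr ltrDl.
have lsE t : ls `]c, t]%classic = (F t)%:E.
  have [ct|tc] := leP c t.
    by rewrite -[F t]subr0 -(F_lt ca); exact: lebesgue_stieltjes_itvoc.
  by rewrite set_itv_ge ?measure0 ?(F_lt (lt_trans tc ca))// bnd_simp -leNgt ltW.
have ls_ca : ls `]c, a[%classic = 0%E.
  apply/negligibleP; first exact: measurable_itv.
  rewrite itv_bnd_open_bigcup; apply: negligible_bigcup => n.
  apply/negligibleP; first exact: measurable_itv.
  by apply: etrans (lsE _) _; rewrite F_lt// ltrBlDr ltrDl invr_gt0.
have mJ : measurable `]c, b]%classic := measurable_itv _.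
have lsJ : (ls `]c, b]%classic < +oo)%E by rewrite lsE ltry.
pose mu : {finite_measure set R -> \bar R} := mfrestr mJ lsJ.
have muE A : mu A = ls (A `&` `]c, b]) by [].
exists mu; split=> [|t].
  apply: etrans (muE _) _; apply: (subset_measure0 _ _ _ ls_ca).
  - by apply: measurableI => //; exact: measurableC.
  - exact: measurable_itv.
  - move=> x [] /=; rewrite !in_itv/= => /negP + /andP[-> xb].
    by rewrite xb andbT -ltNge.
rewrite muE (_ : _ `&` _ = `]c, Num.min t b]%classic); last first.
  apply/seteqP; split=> x /=; rewrite !in_itv/= le_min; first by move=> [-> /andP[-> ->]].
  by move=> /andP[-> /andP[-> ->]].
by rewrite lsE; have [//|/ltW/F_ge->] := leP t b.
Qed.

End CumulativeMeasure.

Section PositiveFunctionals.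
Variables (R : realType) (a b : R).
Implicit Types (g h : R -> R) (s : nat -> R) (c e t : R) (L : (R -> R) -> R).

Definition bounded_borel g :=
  measurable_fun [set: R] g /\ exists K, {in `[a, b], forall x, `|g x| <= K}.

Lemma bounded_borelD g h : bounded_borel g -> bounded_borel h ->
  bounded_borel (fun x => g x + h x).
Proof.
move=> [mg [K gK]] [mh [K' hK']]; split; first exact: measurable_funD.
exists (K + K') => x xab; apply: le_trans (ler_normD _ _) _.
by rewrite lerD ?gK ?hK'.
Qed.

Lemma bounded_borelZ c g : bounded_borel g -> bounded_borel (fun x => c * g x).
Proof.
move=> [mg [K gK]]; split; first exact: measurable_funM.
by exists (`|c| * K) => x xab; rewrite normrM ler_wpM2l// gK.
Qed.

Lemma bounded_borel_cst c : bounded_borel (fun=> c).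
Proof. by split=> //; exists `|c|. Qed.

Lemma bounded_borel_sum n (g_ : 'I_n -> R -> R) : (forall i, bounded_borel (g_ i)) ->
  bounded_borel (fun x => \sum_(i < n) g_ i x).
Proof.
move=> bg; elim: (index_enum _) => [|i r IH].
  by under eq_fun do rewrite big_nil; exact: bounded_borel_cst.
by under eq_fun do rewrite big_cons; exact: bounded_borelD.
Qed.

Lemma bounded_borel_indic (A : set R) : measurable A -> bounded_borel \1_A.
Proof.
move=> mA; split; first exact: measurable_indic.
by exists 1 => x _; rewrite indicE; case: (_ \in _); rewrite ?normr1 ?normr0.
Qed.

Lemma bounded_borel_continuous g : continuous g -> bounded_borel g.
Proof.
move=> cg; split; first exact: continuous_measurable_fun.
have g_compact : compact (g @` `[a, b]).
  by apply: continuous_compact; [exact: continuous_subspaceT | exact: segment_compact].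
have [K [_ gK]] := @compact_bounded _ R^o _ g_compact.
by exists (K + 1) => x xab; apply: (gK (K + 1)); [rewrite ltrDl | exists x].
Qed.

Definition positive_functional L :=
  [/\ forall g h, bounded_borel g -> bounded_borel h ->
        L (fun x => g x + h x) = L g + L h,
      forall c g, bounded_borel g -> L (fun x => c * g x) = c * L g
    & forall g, bounded_borel g -> {in `[a, b], forall x, 0 <= g x} -> 0 <= L g].

Section FunctionalTheory.
Variable L : (R -> R) -> R.
Hypothesis L_pos : positive_functional L.

Lemma functionalB g h : bounded_borel g -> bounded_borel h ->
  L (fun x => g x - h x) = L g - L h.
Proof.
case: L_pos => LD LZ _ bg bh; rewrite -mulN1r -LZ// -LD//; last exact: bounded_borelZ.
by congr L; apply/funext => x; rewrite mulN1r.
Qed.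

Lemma functional_cst c : L (fun=> c) = c * L (fun=> 1).
Proof.
case: L_pos => _ LZ _; rewrite -LZ; last exact: bounded_borel_cst.
by congr L; apply/funext => x; rewrite mulr1.
Qed.

Lemma functional_sum n (c : 'I_n -> R) (g_ : 'I_n -> R -> R) :
  (forall i, bounded_borel (g_ i)) ->
  L (fun x => \sum_(i < n) c i * g_ i x) = \sum_(i < n) c i * L (g_ i).
Proof.
case: L_pos => LD LZ _ bg.
have : forall r : seq 'I_n, bounded_borel (fun x => \sum_(i <- r) c i * g_ i x) /\
    L (fun x => \sum_(i <- r) c i * g_ i x) = \sum_(i <- r) c i * L (g_ i).
  elim=> [|i r [br Lr]].
    under eq_fun do rewrite big_nil.
    by rewrite big_nil functional_cst mul0r; split=> //; exact: bounded_borel_cst.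
  under eq_fun do rewrite big_cons; have bi := bounded_borelZ (c i) (bg i).
  by rewrite big_cons LD// LZ// Lr; split=> //; exact: bounded_borelD.
by move=> /(_ (index_enum _))[].
Qed.

Lemma functional_le g h : bounded_borel g -> bounded_borel h ->
  {in `[a, b], forall x, g x <= h x} -> L g <= L h.
Proof.
move=> bg bh gh; rewrite -subr_ge0 -functionalB//; case: L_pos => _ _; apply=> [|x xab].
  apply: bounded_borelD => //; have := bounded_borelZ (-1) bg.
  by under eq_fun do rewrite mulN1r.
by rewrite subr_ge0 gh.
Qed.

Lemma functional_eq g h : bounded_borel g -> bounded_borel h ->
  {in `[a, b], g =1 h} -> L g = L h.
Proof.
by move=> bg bh gh; apply/le_anti/andP; split; apply: functional_le => // x /gh ->.
Qed.

Lemma functional_dist g h e : bounded_borel g -> bounded_borel h ->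
  {in `[a, b], forall x, `|g x - h x| <= e} -> `|L g - L h| <= e * L (fun=> 1).
Proof.
move=> bg bh gh; case: (L_pos) => LD _ _; have be := bounded_borel_cst e.
have bge := bounded_borelD bg be; have bhe := bounded_borelD bh be.
rewrite -functional_cst ler_distlC lerBlDr -!LD//.
by rewrite !functional_le// => x /gh; rewrite ler_distl => /andP[]; lra.
Qed.

End FunctionalTheory.

Definition step_approx g s m x :=
  g (s m) - \sum_(i < m) (g (s i.+1) - g (s i)) * \1_(`]-oo, s i]) x.

Lemma bounded_borel_step_approx g s m : bounded_borel (step_approx g s m).
Proof.
apply: bounded_borelD; first exact: bounded_borel_cst.
under eq_fun do rewrite -mulN1r.
apply/bounded_borelZ/bounded_borel_sum => i.
by apply: bounded_borelZ; exact: bounded_borel_indic.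
Qed.

Lemma step_approx_dist g s m e x : 0 <= e -> {homo s : i k / (i <= k)%N >-> i <= k} ->
  (forall i, (i < m)%N -> {in `[s i, s i.+1] &, forall u v, `|g u - g v| <= e}) ->
  s 0%N <= x <= s m -> `|g x - step_approx g s m x| <= e.
Proof.
move=> e0 s_homo; rewrite /step_approx.
elim: m => [|m IH] g_osc /andP[s0x xs].
  by rewrite big_ord0 subr0 (le_anti (x := x) (y := s 0%N)) ?xs// subrr normr0.
have [xm|mx] := leP x (s m).
  have := IH (fun i im => g_osc i (ltnW im)); rewrite s0x xm => /(_ isT).
  rewrite big_ord_recr/= indicE mem_setE in_itv/= xm mulr1.
  move: (\sum_(i < m) _) => S.
  by have -> : g x - (g (s m.+1) - (S + (g (s m.+1) - g (s m)))) = g x - (g (s m) - S) by ring.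
rewrite big1 ?subr0 => [|i _].
  by apply: (g_osc m) => //; rewrite in_itv/= ?s_homo//= ?lexx// (ltW mx).
have sim : s i <= s m by apply: s_homo; rewrite -ltnS.
by rewrite indicE mem_setE in_itv/= leNgt (le_lt_trans sim mx) mulr0.
Qed.

Lemma functional_step_approx L g s m : positive_functional L ->
  L (step_approx g s m) = g (s m) * L (fun=> 1)
    - \sum_(i < m) (g (s i.+1) - g (s i)) * L \1_(`]-oo, s i]).
Proof.
move=> L_pos; have b1 i := bounded_borel_indic (measurable_itv `]-oo, s i]).
rewrite functionalB//; first by rewrite functional_cst// functional_sum.
  exact: bounded_borel_cst.
by apply: bounded_borel_sum => i; exact: bounded_borelZ.
Qed.

End PositiveFunctionals.

Section UniformGrid.
Variables (R : realType) (a b : R).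
Implicit Types (g : R -> R) (m i k : nat) (e : R).

Definition grid m i : R := a + (b - a) * (i%:R / m.+1%:R).

Lemma grid0 m : grid m 0 = a.
Proof. by rewrite /grid mul0r mulr0 addr0. Qed.

Lemma grid_last m : grid m m.+1 = b.
Proof. by rewrite /grid divff ?pnatr_eq0// mulr1 addrC subrK. Qed.

Lemma grid_lt m i : a < b -> grid m i < grid m i.+1.
Proof.
by move=> ab; rewrite ltrD2l ltr_pM2l ?subr_gt0// ltr_pM2r ?invr_gt0// ltr_nat.
Qed.

Lemma grid_homo m : a < b -> {homo grid m : i k / (i <= k)%N >-> i <= k}.
Proof. by move=> ab; apply: homo_leq => // [s t u /le_trans|i]; [exact | exact/ltW/grid_lt]. Qed.

Lemma grid_step m i : grid m i.+1 - grid m i = (b - a) * m.+1%:R^-1.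
Proof. by rewrite /grid -natr1; field; rewrite addrC natr1 pnatr_eq0. Qed.

Lemma segment_unif_continuous g e : continuous g -> 0 < e ->
  exists2 d, 0 < d & {in `[a, b], forall x y, `|x - y| < d -> `|g x - g y| <= e}.
Proof.
move=> cg e0; have e2 : 0 < e / 2 by rewrite divr_gt0.
pose modulus d x := forall y, `|x - y| < d -> `|g x - g y| <= e.
have modulus_near : \forall d \near 0^'+, `[a, b] `<=` modulus d.
  have /compact_near_coveringP := @segment_compact R a b; apply=> x _.
  have /cvgrPdist_lt/(_ _ e2)/nbhs_ballP[r /= r0 g_close] := cg x.
  have r2 : 0 < r / 2 by rewrite divr_gt0.
  exists (ball x (r / 2), [set d | d < r / 2]).
    by split; [exact: nbhsx_ballx | exact: nbhs_right_lt].
  move=> [x' d] /= [xx' dr] y x'y.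
  have gx' : `|g x - g x'| < e / 2 by apply/g_close/(le_ball _ xx'); lra.
  have gy : `|g x - g y| < e / 2.
    apply: g_close; move: xx'; rewrite -!ball_normE/= => xx'.
    by rewrite -(subrKA x') (le_lt_trans (ler_normD _ _))//; lra.
  by rewrite -(subrKA (g x)) (le_trans (ler_normD _ _))// distrC; lra.
have /filter_ex[d [d0 d_osc]] : \forall d \near 0^'+, 0 < d /\ `[a, b] `<=` modulus d.
  by near=> d; split; near: d; [exact: nbhs_right_gt | exact: modulus_near].
by exists d.
Unshelve. all: by end_near. Qed.

Lemma grid_oscillation g e : a < b -> continuous g -> 0 < e -> exists m, forall i,
  (i < m.+1)%N -> {in `[grid m i, grid m i.+1] &, forall u v, `|g u - g v| <= e}.
Proof.
move=> ab cg e0; have [d d0 g_osc] := segment_unif_continuous cg e0.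
have db0 : 0 < d / (b - a) by rewrite divr_gt0// subr_gt0.
have [m _ /(_ m (leqnn m)) /= md] := near_infty_natSinv_lt (PosNum db0).
exists m => i im u v; rewrite !in_itv/= => /andP[iu ui] /andP[iv vi]; apply: g_osc.
  have := grid_homo m ab (leq0n i); have := grid_homo m ab im.
  by rewrite grid0 grid_last in_itv/= => *; apply/andP; split; lra.
have : grid m i.+1 - grid m i < d by rewrite grid_step mulrC -ltr_pdivlMr ?subr_gt0.
by rewrite ltr_norml => ?; apply/andP; split; lra.
Qed.

End UniformGrid.

Section FunctionalCdf.
Variables (R : realType) (a b : R) (L : (R -> R) -> R).
Hypothesis L_pos : positive_functional a b L.
Implicit Types s t : R.

Definition functional_cdf t := L \1_(`]-oo, t]).

Let bounded_borel_ray t : bounded_borel a b \1_(`]-oo, t]) :=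
  bounded_borel_indic a b (measurable_itv _).

Lemma functional_cdf_ge0 t : 0 <= functional_cdf t.
Proof. by case: L_pos => _ _; apply=> [|x _]; [exact: bounded_borel_ray | rewrite indicE]. Qed.

Lemma functional_cdf_nd : {homo functional_cdf : s t / s <= t}.
Proof.
move=> s t st.
apply: (functional_le L_pos (bounded_borel_ray s) (bounded_borel_ray t)) => x _.
rewrite !indicE !mem_setE !in_itv/= ler_nat.
by case: leP => // xs; rewrite (le_trans xs st).
Qed.

Lemma functional_cdf_ge t : b <= t -> functional_cdf t = L (fun=> 1).
Proof.
move=> bt; apply: (functional_eq L_pos (bounded_borel_ray t) (bounded_borel_cst a b 1)).
move=> x; rewrite in_itv/= => /andP[_ xb].
by rewrite indicE mem_setE in_itv/= (le_trans xb bt).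
Qed.

Lemma functional_cdf_lt t : t < a -> functional_cdf t = 0.
Proof.
move=> ta; rewrite -(mul0r (L (fun=> 1))) -(functional_cst L_pos).
apply: (functional_eq L_pos (bounded_borel_ray t) (bounded_borel_cst a b 0)) => x.
rewrite in_itv/= => /andP[ax _].
by rewrite indicE mem_setE in_itv/= leNgt (lt_le_trans ta ax).
Qed.

Lemma right_lim_cdf_ge t : b <= t -> right_lim functional_cdf t = L (fun=> 1).
Proof.
move=> bt; have tt1 : t < t + 1 by rewrite ltrDl.
apply/le_anti/andP; split.
  rewrite -(functional_cdf_ge (le_trans bt (ltW tt1))).
  exact: right_lim_le functional_cdf_nd _ _ tt1.
by rewrite -(functional_cdf_ge bt); exact: le_right_lim functional_cdf_nd t.
Qed.

Lemma right_lim_cdf_lt t : t < a -> right_lim functional_cdf t = 0.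
Proof.
move=> ta; have [t_mid mid_a] := midf_lt ta.
apply/le_anti/andP; split.
  by rewrite -(functional_cdf_lt mid_a); exact: right_lim_le functional_cdf_nd _ _ t_mid.
by rewrite -(functional_cdf_lt ta); exact: le_right_lim functional_cdf_nd t.
Qed.

End FunctionalCdf.

Section FunctionalComparison.
Variables (R : realType) (a b : R) (L L' : (R -> R) -> R).
Hypotheses (ab : a < b) (L_pos : positive_functional a b L)
  (L'_pos : positive_functional a b L') (L_mass : L (fun=> 1) = L' (fun=> 1))
  (cdf_le : forall t, functional_cdf L t <= functional_cdf L' t)
  (cdf_lt : forall s t, s < t -> functional_cdf L' s <= functional_cdf L t).
Implicit Types (g : R -> R) (m : nat) (e : R).

(* The increments of L' - L along the grid are dominated by those of the cdf of L, which
   telescope. *)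
Lemma functional_dist_step_approx g m e : 0 <= e ->
  (forall i, (i < m.+1)%N -> `|g (grid a b m i.+1) - g (grid a b m i)| <= e) ->
  `|L (step_approx g (grid a b m) m.+1) - L' (step_approx g (grid a b m) m.+1)|
    <= e * L (fun=> 1).
Proof.
move=> e0 g_osc; set s := grid a b m; pose f i := functional_cdf L (s i).
rewrite (functional_step_approx g s m.+1 L_pos) (functional_step_approx g s m.+1 L'_pos).
rewrite -L_mass opprB addrCA addrAC subrr add0r -sumrB.
apply: le_trans (ler_norm_sum _ _ _) _.
apply: (@le_trans _ _ (\sum_(i < m.+1) e * (f i.+1 - f i))).
  apply: ler_sum => i _; rewrite -mulrBr normrM ler_pM// ?g_osc//.
  by rewrite ger0_norm ?subr_ge0 ?cdf_le// lerD2r cdf_lt// grid_lt.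
rewrite -mulr_sumr -(big_mkord xpredT (fun i => f i.+1 - f i)) telescope_sumr//.
rewrite ler_wpM2l// lerBlDr /f /s grid_last (functional_cdf_ge L_pos (lexx b)) lerDl.
exact: functional_cdf_ge0 L_pos _.
Qed.

Lemma functional_eq_continuous g : continuous g -> L g = L' g.
Proof.
move=> cg; set W := L (fun=> 1); have bg := bounded_borel_continuous a b cg.
have W0 : 0 <= W by case: L_pos => _ _; apply=> //; exact: bounded_borel_cst.
apply/eqP; rewrite -subr_eq0 -normr_le0; apply/ler_addgt0Pr => d d0; rewrite add0r.
have W1 : 0 < 3 * W + 1 by lra.
pose e := d / (3 * W + 1); have e0 : 0 < e by rewrite divr_gt0.
have [m g_osc] := grid_oscillation ab cg e0.
pose h := step_approx g (grid a b m) m.+1.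
have bh : bounded_borel a b h by exact: bounded_borel_step_approx.
have gh : {in `[a, b], forall x, `|g x - h x| <= e}.
  move=> x xab; apply: step_approx_dist => //; first exact: ltW.
    exact: grid_homo.
  by rewrite grid0 grid_last.
have hh : `|L h - L' h| <= e * W.
  apply: functional_dist_step_approx => [|i im]; first exact: ltW.
  by apply: (g_osc i im); rewrite in_itv/= lexx ?andbT ltW// grid_lt.
have := functional_dist L_pos bg bh gh; have := functional_dist L'_pos bg bh gh.
have : e * (3 * W + 1) = d by rewrite divfK// gt_eqF.
by move: hh; rewrite -L_mass -/W !ler_norml; lra.
Qed.

End FunctionalComparison.

Section RieszMarkov.
Variables (R : realType) (a b : R).
Implicit Types (g : R -> R) (mu : {finite_measure set R -> \bar R}).

Lemma bounded_borel_integrable mu g : bounded_borel a b g ->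
  mu.-integrable `[a, b] (EFin \o g).
Proof.
move=> [mg [K gK]]; apply: measurable_bounded_integrable => //.
- by rewrite ltey_eq fin_num_measure.
- exact: measurable_funTS.
- exists K; split; first exact: num_real.
  by move=> k Kk x /= /gK /le_trans; apply; exact: ltW.
Qed.

Lemma positive_functional_integral mu :
  positive_functional a b (fun g => \int[mu]_(x in `[a, b]) g x).
Proof.
split=> [g h bg bh|c g bg|g bg g0].
- by rewrite RintegralD//; exact: bounded_borel_integrable.
- by rewrite RintegralZl//; exact: bounded_borel_integrable.
- by apply: Rintegral_ge0 => x; exact: g0.
Qed.

Theorem riesz_markov (L : (R -> R) -> R) : a < b -> positive_functional a b L ->
  exists mu : {finite_measure set R -> \bar R},
    [/\ carried_by mu `[a, b],
        forall t, mu `]-oo, t]%classic = (right_lim (functional_cdf L) t)%:E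
      & forall g, continuous g -> \int[mu]_(x in `[a, b]) g x = L g].
Proof.
move=> ab L_pos; have cdf_nd := functional_cdf_nd L_pos.
have cdf_b t : b <= t -> right_lim (functional_cdf L) t = right_lim (functional_cdf L) b.
  by move=> bt; rewrite !(right_lim_cdf_ge L_pos).
have [mu [mu_carried mu_cdf]] := cumulative_measure (right_lim_nd cdf_nd)
  (right_lim_right_continuous cdf_nd) (right_lim_cdf_lt L_pos) cdf_b.
have int_pos := positive_functional_integral mu.
have int_cdf t : functional_cdf (fun g => \int[mu]_(x in `[a, b]) g x) t
    = right_lim (functional_cdf L) t.
  by rewrite /functional_cdf carried_Rintegral_indic//; exact: (congr1 fine (mu_cdf t)).
exists mu; split=> // g cg; apply/esym; apply: (functional_eq_continuous ab) cg => //.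
- by rewrite -(functional_cdf_ge int_pos (lexx b)) int_cdf (right_lim_cdf_ge L_pos).
- by move=> t; rewrite int_cdf; exact: le_right_lim.
- by move=> s t st; rewrite int_cdf; exact: right_lim_le.
Qed.

End RieszMarkov.

Section UltraLimits.
Variables (R : realType) (I : Type) (U : set_system I).
Hypothesis UU : UltraFilter U.

Lemma ultra_bounded_cvg (u : I -> R) (K : R) : (forall i, `|u i| <= K) -> cvg (u i @[i --> U]).
Proof.
move=> uK; have [|l [_ u_cluster]] := @segment_compact R (- K) K (u @ U) _.
  by apply: (@filterS _ U _ setT) => [i _|]; [rewrite /= in_itv/= -ler_norml | exact: filterT].
apply/cvg_ex; exists l => V lV.
have [//|UV] := in_ultra_setVsetC (u @^-1` V) UU.
by have [x []] := u_cluster (~` V) V UV lV.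
Qed.

Variables (a b W : R) (L_ : I -> (R -> R) -> R).
Hypotheses (L_pos : forall i, positive_functional a b (L_ i))
  (L_mass : forall i, L_ i (fun=> 1) = W).

Definition ultralim g : R := lim (L_ i g @[i --> U]).

Lemma cvg_ultralim g : bounded_borel a b g -> L_ i g @[i --> U] --> ultralim g.
Proof.
move=> bg; have [_ [K gK]] := bg.
apply: (@ultra_bounded_cvg _ (K * W)) => i.
have := functional_dist (L_pos i) bg (bounded_borel_cst a b 0).
rewrite (functional_cst (L_pos i)) mul0r subr0 L_mass; apply=> x xab.
by rewrite subr0 gK.
Qed.

Lemma positive_functional_ultralim : positive_functional a b ultralim.
Proof.
split=> [g h bg bh|c g bg|g bg g0].
- rewrite [LHS]/ultralim (_ : (fun i => _) = (fun i => L_ i g + L_ i h)).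
    by apply/cvg_lim => //; apply: cvgD; exact: cvg_ultralim.
  by apply/funext => i; case: (L_pos i) => LD _ _; exact: LD.
- rewrite [LHS]/ultralim (_ : (fun i => _) = (fun i => c * L_ i g)).
    by apply/cvg_lim => //; apply: cvgMl_tmp; exact: cvg_ultralim.
  by apply/funext => i; case: (L_pos i) => _ LZ _; exact: LZ.
- apply: (cvgr_to_ge (cvg_ultralim bg)); apply: nearW => i.
  by case: (L_pos i) => _ _; exact.
Qed.

End UltraLimits.

Lemma positive_functional_discrete (R : realType) (a b : R) n (w s : 'I_n -> R) :
  (forall i, 0 <= w i) -> (forall i, s i \in `[a, b]) ->
  positive_functional a b (fun g => \sum_(i < n) w i * g (s i)).
Proof.
move=> w0 s_ab; split=> [g h _ _|c g _|g _ g0].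
- by rewrite -big_split/=; apply: eq_bigr => i _; rewrite mulrDr.
- by rewrite mulr_sumr; apply: eq_bigr => i _; rewrite mulrCA.
- by apply: sumr_ge0 => i _; rewrite mulr_ge0// g0.
Qed.

(** * The Hausdorff moment problem *)

Section BernsteinPolynomials.
Variables (F : fieldType) (M : F).
Hypothesis M_neq0 : M != 0.

Definition bernstein n k : {poly F} :=
  ('C(n, k)%:R / M ^+ n) *: ('X^k * (M%:P - 'X) ^+ (n - k)).

Lemma bernstein_sum n : \sum_(k < n.+1) bernstein n k = 1.
Proof.
have MX0 : M ^+ n != 0 by rewrite expf_neq0.
transitivity ((M ^+ n)^-1 *: (M%:P - 'X + 'X) ^+ n).
  rewrite exprDn scaler_sumr; apply: eq_bigr => k _.
  by rewrite /bernstein mulrC -scalerA scaler_nat mulrC.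
by rewrite subrK -rmorphXn/= -mul_polyC -rmorphM mulVf.
Qed.

Lemma bernsteinSS n k :
  k.+1%:R *: bernstein n.+1 k.+1 = (n.+1%:R / M) *: ('X * bernstein n k).
Proof.
have coefE : k.+1%:R * ('C(n.+1, k.+1)%:R / M ^+ n.+1) = n.+1%:R / M * ('C(n, k)%:R / M ^+ n).
  by rewrite mulrA -natrM -mul_bin_diag natrM exprS invfM /=; ring.
by rewrite /bernstein scalerA coefE subSS -scalerAr ['X * (_ * _)]mulrA -exprS scalerA.
Qed.

Lemma bernstein_ffact_sum n j :
  \sum_(k < n.+1) (k ^_ j)%:R *: bernstein n k = ((n ^_ j)%:R / M ^+ j) *: 'X^j.
Proof.
elim: j n => [|j IH] n.
  rewrite divr1 !expr0 scale1r -(bernstein_sum n).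
  by apply: eq_bigr => k _; rewrite scale1r.
rewrite big_ord_recl ffact0n scale0r add0r; case: n => [|n].
  by rewrite big_ord0 ffact0n mul0r scale0r.
under eq_bigr => k _ do rewrite lift0 ffactSS mulnC natrM -scalerA bernsteinSS scalerA mulrC
  -scalerA scalerAr.
rewrite -scaler_sumr -mulr_sumr IH ffactSS natrM -scalerAr -exprS scalerA.
by congr (_ *: _); rewrite exprS invfM; ring.
Qed.

End BernsteinPolynomials.

Lemma ffact_le_expn k j : (k ^_ j <= k ^ j)%N.
Proof. by elim: j => // j IH; rewrite ffactnSr expnSr leq_mul ?leq_subr. Qed.

Lemma expr_ffact_dist (R : realFieldType) (n k j : nat) : (0 < n)%N -> (k <= n)%N ->
  `|(k%:R / n%:R) ^+ j - (k ^_ j)%:R / n%:R ^+ j| <= (j ^ 2)%:R / n%:R :> R.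
Proof.
move=> n_gt0 kn; have n0 : 0 < n%:R :> R by rewrite ltr0n.
have x0 : 0 <= k%:R / n%:R :> R by rewrite divr_ge0.
have x1 : k%:R / n%:R <= 1 :> R by rewrite ler_pdivrMr// mul1r ler_nat.
have ff_ge0 i : 0 <= (k ^_ i)%:R / n%:R ^+ i :> R by rewrite divr_ge0// exprn_ge0// ltW.
have ff_le1 i : (k ^_ i)%:R / n%:R ^+ i <= 1 :> R.
  rewrite ler_pdivrMr ?exprn_gt0// mul1r -natrX ler_nat (leq_trans (ffact_le_expn k i))//.
  by case: i => // i; rewrite leq_exp2r.
elim: j => [|j IH]; first by rewrite !expr0 divr1 subrr normr0 mul0r.
have shift : 0 <= k%:R - (k - j)%:R :> R /\ k%:R - (k - j)%:R <= j%:R :> R.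
  by split; rewrite ?subr_ge0 ?lerBlDr -?natrD ler_nat; lia.
have -> : (k%:R / n%:R) ^+ j.+1 - (k ^_ j.+1)%:R / n%:R ^+ j.+1 =
    k%:R / n%:R * ((k%:R / n%:R) ^+ j - (k ^_ j)%:R / n%:R ^+ j)
    + (k ^_ j)%:R / n%:R ^+ j * ((k%:R - (k - j)%:R) / n%:R) :> R.
  by rewrite ffactnSr natrM !exprS invfM; ring.
apply: le_trans (ler_normD _ _) _; rewrite normrM (ger0_norm x0) normrM (ger0_norm (ff_ge0 j)).
have j1 : j%:R <= (j * 2).+1%:R :> R by rewrite ler_nat; lia.
apply: (@le_trans _ _ ((j ^ 2)%:R / n%:R + (j * 2).+1%:R / n%:R)).
  apply: lerD; first by apply: le_trans IH; rewrite ler_piMl.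
  case: shift => shift0 shiftj; apply: le_trans (ler_piMl _ (ff_le1 j)) _ => //.
  by rewrite ger0_norm ?divr_ge0 ?(ltW n0)// ler_pM2r ?invr_gt0// (le_trans shiftj).
by rewrite -mulrDl -natrD ler_pM2r ?invr_gt0// ler_nat; lia.
Qed.

Section RieszFunctional.
Variable R : comNzRingType.
Implicit Types (c : nat -> R) (p : {poly R}).

Definition riesz_functional c p : R := \sum_(i < size p) p`_i * c i.

Lemma riesz_functional_widen c p n : (size p <= n)%N ->
  riesz_functional c p = \sum_(i < n) p`_i * c i.
Proof.
move=> pn; rewrite /riesz_functional (big_ord_widen n (fun i => p`_i * c i) pn) big_mkcond.
by apply: eq_bigr => i _; case: ltnP => // ip; rewrite nth_default// mul0r.
Qed.

Lemma riesz_functional_is_scalar c : scalar (riesz_functional c).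
Proof.
move=> a p q; pose n := maxn (size p) (size q).
rewrite !(@riesz_functional_widen c _ n) ?leq_maxl ?leq_maxr//; last first.
  apply: leq_trans (size_polyD _ _) _.
  by rewrite geq_max leq_maxr andbT (leq_trans (size_scale_leq _ _))// leq_maxl.
rewrite mulr_sumr -big_split/=; apply: eq_bigr => i _.
by rewrite coefD coefZ mulrDl mulrA.
Qed.

HB.instance Definition _ c :=
  GRing.isLinear.Build R {poly R} R *%R (riesz_functional c) (riesz_functional_is_scalar c).

Lemma riesz_functionalXn c n : riesz_functional c 'X^n = c n.
Proof.
rewrite (@riesz_functional_widen c _ n.+1) ?size_polyXn// big_ord_recr/= coefXn eqxx mul1r.
by rewrite big1 ?add0r// => i _; rewrite coefXn ltn_eqF ?mul0r.
Qed.

End RieszFunctional.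

Section HausdorffMomentProblem.
Variables (R : realType) (M : R) (Lambda : {scalar {poly R}}).
Hypothesis M_gt0 : 0 < M.

Definition bernstein_functional n (g : R -> R) : R :=
  \sum_(k < n.+1) Lambda (bernstein M n k) * g (M * (k%:R / n%:R)).

Definition hausdorff_functional (U : set_system nat) := ultralim U bernstein_functional.

Hypothesis Lambda_pos : forall k l, 0 <= Lambda ('X^k * (M%:P - 'X) ^+ l).

Let M_neq0 : M != 0. Proof. by rewrite gt_eqF. Qed.

Let bernstein_ge0 n k : 0 <= Lambda (bernstein M n k).
Proof. by rewrite /bernstein scalarZ/= mulr_ge0// divr_ge0// exprn_ge0// ltW. Qed.

Lemma bernstein_functional_pos n : positive_functional 0 M (bernstein_functional n).
Proof.
apply: positive_functional_discrete => // k.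
rewrite in_itv/= mulr_ge0 ?divr_ge0 ?(ltW M_gt0)//= ler_piMr ?(ltW M_gt0)//.
case: n k => [|n] k; first by rewrite invr0 mulr0.
by rewrite ler_pdivrMr ?ltr0n// mul1r ler_nat -ltnS.
Qed.

Lemma bernstein_functional1 n : bernstein_functional n (fun=> 1) = Lambda 1.
Proof.
rewrite -(bernstein_sum M_neq0 n) linear_sum.
by apply: eq_bigr => k _; rewrite mulr1.
Qed.

Let ffact_moment n j :
  \sum_(k < n.+1) Lambda (bernstein M n k) * (k ^_ j)%:R = (n ^_ j)%:R / M ^+ j * Lambda 'X^j.
Proof.
rewrite -scalarZ -bernstein_ffact_sum// linear_sum.
by apply: eq_bigr => k _; rewrite [in RHS]scalarZ mulrC.
Qed.

(* The factorial moments of the weights are exact, and k ^_ j / n ^ j is close to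
   (k / n) ^ j. *)
Lemma bernstein_monomial_dist n j : (0 < n)%N ->
  `|bernstein_functional n (fun x => x ^+ j) - Lambda 'X^j|
    <= (j ^ 2)%:R * (M ^+ j * Lambda 1 + `|Lambda 'X^j|) / n%:R.
Proof.
move=> n_gt0; have n0 : n%:R != 0 :> R by rewrite pnatr_eq0 -lt0n.
have Mj0 : 0 <= M ^+ j by rewrite exprn_ge0// ltW.
pose r : R := (n ^_ j)%:R / n%:R ^+ j.
have sum_ffact : r * Lambda 'X^j =
    M ^+ j * \sum_(k < n.+1) Lambda (bernstein M n k) * ((k ^_ j)%:R / n%:R ^+ j).
  under eq_bigr do rewrite mulrA.
  rewrite -mulr_suml ffact_moment /r; field.
  by rewrite !expf_neq0.
have sum_close : `|bernstein_functional n (fun x => x ^+ j) - r * Lambda 'X^j|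
    <= M ^+ j * ((j ^ 2)%:R / n%:R * Lambda 1).
  rewrite sum_ffact /bernstein_functional.
  under [X in X - _]eq_bigr do rewrite exprMn mulrCA.
  rewrite -mulr_sumr -mulrBr normrM ger0_norm// ler_wpM2l// -sumrB.
  rewrite -(bernstein_functional1 n) mulr_sumr.
  apply: le_trans (ler_norm_sum _ _ _) _; apply: ler_sum => k _.
  rewrite -mulrBr normrM mulr1 mulrC (ger0_norm (bernstein_ge0 _ _)).
  by rewrite ler_wpM2r// expr_ffact_dist// -ltnS.
have r_close : `|r - 1| <= (j ^ 2)%:R / n%:R.
  by have := @expr_ffact_dist R n n j n_gt0 (leqnn _); rewrite divff// expr1n distrC.
rewrite -(subrKA (r * Lambda 'X^j)); apply: le_trans (ler_normD _ _) _.
have := ler_wpM2r (normr_ge0 (Lambda 'X^j)) r_close.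
by rewrite -normrM mulrBl mul1r; move: sum_close; lra.
Qed.

Lemma cvg_bernstein_monomial j :
  bernstein_functional n (fun x => x ^+ j) @[n --> \oo] --> Lambda 'X^j.
Proof.
pose c := (j ^ 2)%:R * (M ^+ j * Lambda 1 + `|Lambda 'X^j|).
rewrite -(cvg_shiftS (fun n => bernstein_functional n (fun x => x ^+ j))).
apply/subr_cvg0/norm_cvg0P; apply: (@squeeze_cvgr _ _ _ _ (fun=> 0) (fun n => c * n.+1%:R^-1)).
- by apply: nearW => n; rewrite normr_ge0 bernstein_monomial_dist.
- exact: cvg_cst.
- by rewrite -[X in _ --> X](mulr0 c); apply: cvgMl_tmp; exact: cvg_harmonic.
Qed.

Lemma cvg_bernstein_functional p : bernstein_functional n (horner p) @[n --> \oo] --> Lambda p.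
Proof.
rewrite -[X in _ --> Lambda X]coefK poly_def linear_sum.
have -> : (fun n => bernstein_functional n (horner p)) =
    (fun n => \sum_(j < size p) p`_j * bernstein_functional n (fun x => x ^+ j)).
  apply/funext => n; under [RHS]eq_bigr do rewrite mulr_sumr.
  rewrite exchange_big; apply: eq_bigr => k _ /=.
  by rewrite horner_coef mulr_sumr; apply: eq_bigr => j _; rewrite mulrCA.
apply: cvg_big => [|j _]; first exact: add_continuous.
by rewrite scalarZ; apply: cvgMl_tmp; exact: cvg_bernstein_monomial.
Qed.

Variable U : set_system nat.
Hypotheses (UU : UltraFilter U) (U_oo : \oo `<=` U).

Lemma cvg_hausdorff_functional g : bounded_borel 0 M g ->
  bernstein_functional n g @[n --> U] --> hausdorff_functional U g.
Proof.
move=> bg; apply: cvg_ultralim bg.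
- exact: bernstein_functional_pos.
- exact: bernstein_functional1.
Qed.

Lemma hausdorff_functional_pos : positive_functional 0 M (hausdorff_functional U).
Proof.
apply: positive_functional_ultralim.
- exact: bernstein_functional_pos.
- exact: bernstein_functional1.
Qed.

Theorem hausdorff_moment : exists mu : {finite_measure set R -> \bar R},
  [/\ carried_by mu `[0, M],
      forall t, mu `]-oo, t]%classic =
        (right_lim (functional_cdf (hausdorff_functional U)) t)%:E
    & forall p, \int[mu]_(x in `[0, M]) p.[x] = Lambda p].
Proof.
have [mu [mu_carried mu_cdf mu_int]] := riesz_markov M_gt0 hausdorff_functional_pos.
exists mu; split=> // p; rewrite mu_int; last exact: continuous_horner.
apply/cvg_lim => // V /(@cvg_bernstein_functional p) pV; exact: U_oo.
Qed.

End HausdorffMomentProblem.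

(** * The spectral measures of a positive operator *)

Lemma quadratic_form_measure (R : realType) (H : hilbertType R)
    (mu : H -> {finite_measure set R -> \bar R}) :
  quadratic_form (fun h => fine (mu h setT)) ->
  (forall t, quadratic_form (fun h => fine (mu h `]-oo, t]%classic))) ->
  forall S, measurable S -> quadratic_form (fun h => fine (mu h S)).
Proof.
move=> quadT quad_cdf; have mu_fin h A : measurable A -> mu h A \is a fin_num.
  exact: fin_num_measure.
have quadC A : measurable A -> quadratic_form (fun h => fine (mu h A)) ->
    quadratic_form (fun h => fine (mu h (~` A))).
  move=> mA /(quadratic_formZ (-1))/(quadratic_formD quadT).
  congr quadratic_form; apply/funext => h; rewrite mulN1r -fineB ?mu_fin//; congr fine.
  by rewrite -(setvU A) measureU ?setICl ?addeK ?mu_fin//; exact: measurableC.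
have genE := RGenOInfty.measurableE R.
move=> S mS; apply: (@dynkin_induction _ R _
  (fun A => quadratic_form (fun h => fine (mu h A))) genE) => //.
- move=> _ _ [s ->] [t ->]; exists (Num.max s t).
  by apply/seteqP; split => x /=; rewrite !in_itv/= !andbT gt_max => /andP.
- by move=> _ [t ->]; rewrite -setCitvl; exact: quadC.
- move=> A mA tA quadA.
  apply: (@quadratic_form_lim _ _ _ \oo (fun n h => \sum_(i < n) fine (mu h (A i)))).
    by move=> n; exact: quadratic_form_sum.
  move=> h; have mUA : measurable (\bigcup_k A k) by exact: bigcup_measurable.
  have /fine_cvg : (\sum_(0 <= i < n) mu h (A i))%E @[n --> \oo]
      --> (fine (mu h (\bigcup_k A k)))%:E.
    by rewrite fineK ?mu_fin//; exact: measure_semi_sigma_additive.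
  apply: cvg_trans; apply: near_eq_cvg; apply: nearW => n /=.
  by rewrite big_mkord sum_fine// => i _; exact: mu_fin.
- by have : (@RGenOInfty.G R).-sigma.-measurable S by rewrite -genE.
Qed.

Section MomentFunctional.
Variables (R : realType) (H : hilbertType R) (N : bop H).
Hypothesis N_sa : selfadjoint N.
Implicit Types (h x y : H) (p : {poly R}) (n : nat).

Definition moment_functional h : {scalar {poly R}} :=
  riesz_functional (fun n => rdot (iter n N h) h).

Lemma moment_functionalXn h n : moment_functional h 'X^n = rdot (iter n N h) h.
Proof. exact: riesz_functionalXn. Qed.

Lemma moment_functional1 h : moment_functional h 1 = rdot h h.
Proof. exact: (moment_functionalXn h 0). Qed.

Lemma moment_functionalX h : moment_functional h 'X = rdot (N h) h.
Proof. exact: (moment_functionalXn h 1). Qed.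

Lemma quadratic_form_moment p : quadratic_form (fun h => moment_functional h p).
Proof.
apply: quadratic_form_sum => i; apply: quadratic_formZ.
by under eq_fun do rewrite -bop_iterE; exact: quadratic_form_rdot.
Qed.

Lemma inner_selfadjoint_iter n x y : inner (iter n N x) y = inner x (iter n N y).
Proof. by elim: n x y => //= n IH x y; rewrite inner_adjoint N_sa IH -iterSr. Qed.

Lemma rdot_selfadjoint x y : rdot (N x) y = rdot x (N y).
Proof. by rewrite /rdot (inner_selfadjoint_iter 1). Qed.

Lemma inner_selfadjoint_iter_real n h : inner (iter n N h) h = (rdot (iter n N h) h)%:C.
Proof.
have := inner_conj (iter n N h) h; rewrite -inner_selfadjoint_iter /rdot.
case: (inner _ _) => u v /eqP; rewrite eq_complex/= => /andP[_ /eqP v0].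
by rewrite (_ : v = 0)//; lra.
Qed.

(* That is, the spectral measure of (N - a) h has density (x - a)^2 with respect to that
   of h. *)
Lemma moment_functional_shift a h p :
  moment_functional (N h - a%:C *: h) p = moment_functional h (('X - a%:P) ^+ 2 * p).
Proof.
rewrite -(coefK p) poly_def mulr_sumr !linear_sum; apply: eq_bigr => i _.
rewrite -scalerAr !scalarZ; congr (_ * _).
have -> : ('X - a%:P) ^+ 2 * 'X^i = 'X^(i.+2) - (a *+ 2) *: 'X^(i.+1) + a ^+ 2 *: 'X^i.
  by rewrite -!mul_polyC rmorphMn rmorphXn !exprS/=; ring.
rewrite linearD linearB !scalarZ !moment_functionalXn.
rewrite -!bop_iterE linearB linearZ !bop_iterE -!iterSr.
rewrite !(rdotDl, rdotDr, rdotNl, rdotNr, rdotZl, rdotZr) -!rdot_selfadjoint -!iterS.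
by ring.
Qed.

Variable M : R.
Hypotheses (M_gt0 : 0 < M) (N_pos : forall x, 0 <= rdot (N x) x)
  (N_le : forall x, rdot (N x) x <= M * rdot x x).

Lemma moment_functional_ge0 h k l : 0 <= moment_functional h ('X^k * (M%:P - 'X) ^+ l).
Proof.
have shiftX x i p : moment_functional x ('X^(i.+2) * p) = moment_functional (N x) ('X^i * p).
  have := moment_functional_shift 0 x ('X^i * p).
  by rewrite scale0r !subr0 => ->; rewrite !exprS !expr0 mulr1 !mulrA.
have shiftM x p j : moment_functional x (p * (M%:P - 'X) ^+ j.+2) =
    moment_functional (N x - M%:C *: x) (p * (M%:P - 'X) ^+ j).
  by rewrite moment_functional_shift -sqrrN opprB [in RHS]mulrCA -exprD.
have M_sub x : 0 <= moment_functional x (M%:P - 'X).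
  rewrite -[M%:P]mulr1 mul_polyC linearB scalarZ/= moment_functional1 moment_functionalX.
  by rewrite subr_ge0.
elim/ltn_ind: k h l => -[|[|k]] IHk h l; last by rewrite shiftX; exact: IHk.
  elim/ltn_ind: l h => -[|[|l]] IHl h; last by rewrite shiftM; exact: IHl.
    by rewrite mulr1 moment_functional1 rdot_ge0.
  by rewrite mul1r expr1.
elim/ltn_ind: l h => -[|[|l]] IHl h; last by rewrite shiftM; exact: IHl.
  by rewrite mulr1 moment_functionalX.
rewrite -(pmulr_rge0 _ M_gt0) -scalarZ.
have -> : M *: ('X^1 * (M%:P - 'X) ^+ 1) = 'X^2 * (M%:P - 'X) + 'X * (M%:P - 'X) ^+ 2.
  by rewrite -mul_polyC; ring.
rewrite linearD addr_ge0//.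
  by rewrite shiftX mul1r.
by rewrite shiftM mulr1 moment_functionalX.
Qed.

Theorem spectral_measures : exists mu : H -> {finite_measure set R -> \bar R},
  [/\ forall h, carried_by (mu h) `[0, M],
      forall h, fine (mu h setT) = rdot h h,
      forall S, measurable S -> quadratic_form (fun h => fine (mu h S))
    & forall h p, \int[mu h]_(x in `[0, M]) p.[x] = moment_functional h p].
Proof.
have [U [UU U_oo]] := @ultraFilterLemma _ \oo _.
have /choice[mu muP] h := hausdorff_moment M_gt0 (moment_functional_ge0 h) UU U_oo.
have mu_carried h : carried_by (mu h) `[0, M] by case: (muP h).
have mu_int h p : \int[mu h]_(x in `[0, M]) p.[x] = moment_functional h p by case: (muP h).
have muT h : fine (mu h setT) = rdot h h.
  rewrite -(carried_setI _ (mu_carried h) measurableT)// setTI -[LHS]mul1r -Rintegral_cst//.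
  by rewrite -moment_functional1 -mu_int; apply: eq_Rintegral => x _; rewrite hornerC.
pose L h := hausdorff_functional M (moment_functional h) U.
have L_quad g : bounded_borel 0 M g -> quadratic_form (fun h => L h g).
  move=> bg; apply: (@quadratic_form_lim _ _ _ U
      (fun n h => bernstein_functional M (moment_functional h) n g)).
    move=> n; apply: quadratic_form_sum => k.
    by under eq_fun do rewrite mulrC; exact/quadratic_formZ/quadratic_form_moment.
  by move=> h; apply: cvg_hausdorff_functional => //; exact: moment_functional_ge0.
exists mu; split=> //; apply: quadratic_form_measure => [|t].
  by under eq_fun do rewrite muT; exact: (quadratic_form_rdot bop_id).
apply: (@quadratic_form_lim _ _ _ t^'+ (fun u h => L h \1_(`]-oo, u]))) => [u|h].
  exact/L_quad/bounded_borel_indic.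
case: (muP h) => _ -> _; apply: cvg_right_lim; apply: functional_cdf_nd.
exact/hausdorff_functional_pos/moment_functional_ge0.
Qed.

End MomentFunctional.

Theorem semispectral_resolution (R : realType) (H : hilbertType R) (N : bop H) (M : R) :
  selfadjoint N -> 0 < M -> (forall x, 0 <= rdot (N x) x) ->
  (forall x, rdot (N x) x <= M * rdot x x) ->
  exists (E : set R -> bop H) (mu : H -> {finite_measure set R -> \bar R}),
  [/\ forall h, carried_by (mu h) `[0, M],
      forall S h, measurable S -> inner (E S h) h = (fine (mu h S))%:C
    & forall h p, \int[mu h]_(x in `[0, M]) p.[x] = moment_functional N h p].
Proof.
move=> N_sa M_gt0 N_pos N_le.
have [mu [mu_carried muT mu_quad mu_int]] := spectral_measures N_sa M_gt0 N_pos N_le.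
have /choice[E EP] S : exists T : bop H, measurable S ->
    forall h, inner (T h) h = (fine (mu h S))%:C.
  have [mS|nmS] := pselect (measurable S); last by exists bop_id.
  have [|T TE] := @jordan_von_neumann _ _ _ 1 (mu_quad S mS); last by exists T.
  move=> h; rewrite fine_ge0//= mul1r -muT fine_le ?fin_num_measure//.
  by rewrite le_measure ?inE.
by exists E, mu; split=> // S h mS; exact: EP.
Qed.

Lemma natrM_expr_onem_le1 (R : realDomainType) (z : R) k : 0 <= z <= 1 ->
  k%:R * z * (1 - z) ^+ k <= 1.
Proof.
move=> /andP[z0 z1]; suff : (1 + k%:R * z) * (1 - z) ^+ k <= 1.
  by apply: le_trans; rewrite ler_wpM2r ?exprn_ge0 ?subr_ge0// lerDr.
elim: k => [|k IH]; first by rewrite mul0r addr0 mulr1.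
apply: le_trans IH; rewrite exprS mulrA ler_wpM2r ?exprn_ge0 ?subr_ge0//.
have : 0 <= k.+1%:R * z ^+ 2 by rewrite mulr_ge0 ?sqr_ge0.
by rewrite -natr1; lra.
Qed.

Section AtomOfDensity.
Variables (R : realType) (a b c : R) (mu nu : {finite_measure set R -> \bar R}).
Hypotheses (nu_carried : carried_by nu `[a, b])
  (nu_density : forall p : {poly R}, \int[nu]_(x in `[a, b]) p.[x] =
    \int[mu]_(x in `[a, b]) (('X - c%:P) ^+ 2 * p).[x]).

Let d := 1 + `|a - c| + `|b - c|.

Let d_gt0 : 0 < d.
Proof. by rewrite /d -addrA ltr_pwDl// addr_ge0. Qed.

Let sqr_ratio01 x : x \in `[a, b] -> 0 <= (x - c) ^+ 2 / d ^+ 2 <= 1.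
Proof.
rewrite in_itv/= => /andP[ax xb]; have d0 := d_gt0.
have xd : `|x - c| <= d.
  have := ler_norm (b - c); have := ler_norm (c - a); rewrite /d ler_norml (distrC a).
  have := normr_ge0 (b - c); have := normr_ge0 (c - a).
  by move=> *; apply/andP; split; lra.
rewrite divr_ge0 ?sqr_ge0//= ler_pdivrMr ?exprn_gt0// mul1r.
by rewrite -real_normK ?num_real// lerXn2r ?nnegrE// ltW.
Qed.

Let bump k : {poly R} := (1 - (d ^- 2) *: ('X - c%:P) ^+ 2) ^+ k.

Let horner_bump k x : (bump k).[x] = (1 - (x - c) ^+ 2 / d ^+ 2) ^+ k.
Proof.
by rewrite horner_exp hornerD hornerN hornerZ horner_exp hornerXsubC hornerC mulrC.
Qed.

Let bounded_borel_horner (p : {poly R}) : bounded_borel a b (horner p).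
Proof. by apply/bounded_borel_continuous/continuous_horner. Qed.

Let atom_le_bump k : fine (nu [set c]) <= \int[nu]_(x in `[a, b]) (bump k).[x].
Proof.
rewrite -(carried_Rintegral_indic _ nu_carried)//.
apply: (functional_le (positive_functional_integral a b nu)).
- exact: bounded_borel_indic.
- exact: bounded_borel_horner.
move=> x /sqr_ratio01/andP[_ z1]; rewrite horner_bump indicE.
case: (boolP (x \in _)) => [/set_mem ->|_]; last by rewrite exprn_ge0// subr_ge0.
by rewrite subrr expr0n mul0r subr0 expr1n.
Qed.

Let bump_density_le k :
  k%:R * \int[nu]_(x in `[a, b]) (bump k).[x] <= d ^+ 2 * fine (mu `[a, b]%classic).
Proof.
have mu_pos := positive_functional_integral a b mu; case: (mu_pos) => _ muZ _.
rewrite nu_density -muZ// -Rintegral_cst//.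
apply: (functional_le mu_pos); [exact/bounded_borelZ | exact: bounded_borel_cst |].
move=> x /sqr_ratio01/(natrM_expr_onem_le1 k).
rewrite -(@ler_pM2l _ (d ^+ 2)) ?exprn_gt0 ?d_gt0// mulr1; apply: le_trans.
rewrite hornerM horner_exp hornerXsubC horner_bump le_eqVlt; apply/orP; left; apply/eqP.
by field; rewrite gt_eqF ?d_gt0.
Qed.

(* The density (x - c)^2 of nu vanishes at c: the polynomials bump k are 1 at c while
   (x - c)^2 bump k is of order 1 / k on [a, b]. *)
Lemma density_atom_eq0 : nu [set c] = 0%E.
Proof.
transitivity (fine (nu [set c]))%:E; first by rewrite fineK// fin_num_measure.
congr (_%:E); apply/le_anti; rewrite fine_ge0//= andbT.
apply: (@natrM_bounded_le0 _ _ (d ^+ 2 * fine (mu `[a, b]%classic))) => k.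
by apply: le_trans (bump_density_le k); rewrite ler_wpM2l// atom_le_bump.
Qed.

End AtomOfDensity.

Section QPolynomials.
Variable R : realType.

Definition Qpoly n : {poly R} := \sum_(0 <= j < n.-1) (n - j - 1)%:R *: 'X^j.

Lemma horner_Qpoly n (x : R) : (Qpoly n).[x] = Qpol n x.
Proof. by rewrite horner_sum; apply: eq_bigr => j _; rewrite hornerZ hornerXn. Qed.

Lemma QpolyS n : Qpoly n.+1 = Qpoly n + \sum_(0 <= j < n) 'X^j.
Proof.
case: n => [|n]; first by rewrite /Qpoly !big_nil addr0.
rewrite /Qpoly/= [LHS]big_nat_recr//= [\sum_(0 <= j < n.+1) _]big_nat_recr//= addrA -big_split/=.
congr (_ + _); last by rewrite (_ : (n.+2 - n - 1 = 1)%N) ?scale1r//; lia.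
apply: eq_big_nat => j jn; rewrite (_ : (n.+2 - j - 1 = (n.+1 - j - 1).+1)%N); last by lia.
by rewrite -natr1 scalerDl scale1r.
Qed.

Lemma mul_sqr_Qpoly n : ('X - 1) ^+ 2 * Qpoly n = 'X^n - 1 - n%:R *: ('X - 1).
Proof.
elim: n => [|n IH]; first by rewrite /Qpoly big_nil mulr0 subrr scale0r subr0.
have geom : ('X - 1) * \sum_(0 <= j < n) 'X^j = 'X^n - 1 :> {poly R}.
  by rewrite big_mkord subrX1.
rewrite QpolyS mulrDr IH expr2 -mulrA geom -natr1 scalerDl scale1r exprS.
by ring.
Qed.

End QPolynomials.

Lemma scalar_measure_Rintegral (R : realType) (H : hilbertType R) (F : set R -> bop H)
    (h : H) (mu nu : {finite_measure set R -> \bar R}) (M : R) (g : R -> R) :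
  scalar_measure F h mu -> scalar_measure F h nu -> carried_by mu `[0, M] -> continuous g ->
  nu.-integrable (@Rplus R) (EFin \o g) /\
  \int[nu]_(x in @Rplus R) g x = \int[mu]_(x in `[0, M]) g x.
Proof.
move=> muF nuF mu_carried cg.
have numu A : measurable A -> A `<=` @Rplus R -> nu A = mu A.
  move=> mA sA; have := nuF A (conj mA sA); rewrite (muF A (conj mA sA)) => /complexI eq_fine.
  by rewrite -[LHS]fineK ?fin_num_measure// -eq_fine fineK// fin_num_measure.
have KRp : `[0, M] `<=` @Rplus R by move=> x /=; rewrite /Rplus/= !in_itv/= => /andP[->].
have mg : measurable_fun (@Rplus R) g.
  by apply: measurable_funTS; exact: continuous_measurable_fun.
have ig : mu.-integrable `[0, M] (EFin \o g).
  by apply: bounded_borel_integrable; exact: bounded_borel_continuous.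
have [igR <-] := carried_Rintegral (measurable_itv _) mu_carried (measurable_itv _) KRp mg ig.
exact: eq_measure_Rintegral numu igR.
Qed.

Section PowerRepresentation.
Variables (R : realType) (H : hilbertType R) (N : bop H) (M : R).
Hypotheses (N_sa : selfadjoint N) (M_gt0 : 0 < M)
  (N_pos : forall x, 0 <= rdot (N x) x) (N_le : forall x, rdot (N x) x <= M * rdot x x).
Implicit Types (h x : H) (n : nat).

Local Notation L := (bop_sub N bop_id).

Let L_sa : selfadjoint L.
Proof. by apply: selfadjoint_bop_sub => //; exact: selfadjoint_bop_id. Qed.

Let moment_functional_mul_Qpoly h n :
  (moment_functional N h (('X - 1%:P) ^+ 2 * Qpoly R n))%:C =
  inner (iter n N h - h - n%:R *: L h) h.
Proof.
rewrite mul_sqr_Qpoly !linearB !scalarZ/=.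
rewrite moment_functional1 moment_functionalX moment_functionalXn.
rewrite -(rmorph_nat (real_complex R)) !(innerDl, innerNl, innerZl).
rewrite (inner_selfadjoint_iter_real N_sa).
rewrite (inner_selfadjoint_iter_real N_sa 1) inner_norm norm_rdot.
by rewrite !(rmorphD, rmorphN, rmorphM)/=; ring.
Qed.

Theorem power_representation : exists F : set R -> bop H,
  [/\ semispectral F, compactly_supported F, forall h, F [set 1] h = 0
    & forall n, exists2 S : bop H, is_op_integral F (Qpol n) S
        & forall x, iter n N x = x + n%:R *: L x + S x].
Proof.
have [E [mu [mu_carried EE mu_int]]] := semispectral_resolution N_sa M_gt0 N_pos N_le.
pose F A := bop_comp L (bop_comp (E A) L).
have FE A h : measurable A -> inner (F A h) h = (fine (mu (L h) A))%:C.
  by move=> mA; rewrite (inner_adjoint L) L_sa EE.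
have F_scalar h : scalar_measure F h (mu (L h)) by move=> A [mA _]; rewrite FE.
have F_eq0 A : measurable A -> (forall h, mu (L h) A = 0%E) -> forall h, F A h = 0.
  by move=> mA A0; apply: quad_eq0 => h; rewrite FE// A0.
have L_density h p : \int[mu (L h)]_(x in `[0, M]) p.[x] =
    \int[mu h]_(x in `[0, M]) (('X - 1%:P) ^+ 2 * p).[x].
  by rewrite !mu_int -moment_functional_shift// scale1r.
exists F; split.
- by move=> h; exists (mu (L h)).
- exists `[0, M]%classic; split; first exact: segment_compact.
    by move=> x /=; rewrite /Rplus/= !in_itv/= => /andP[->].
  have mC : measurable (@Rplus R `\` `[0, M]) by apply: measurableD => //; exact: measurable_itv.
  by apply: F_eq0 => // h; apply: (carried_subset0 _ (mu_carried (L h))) => // x [].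
- apply: F_eq0 => // h; exact: density_atom_eq0 (mu_carried (L h)) (L_density h).
move=> n; exists (bop_sub (bop_sub (bop_iter n N) bop_id) (bop_scale n%:R L)).
  move=> h nu nuF; have QE : Qpol n = horner (Qpoly R n).
    by apply/funext => x; rewrite horner_Qpoly.
  have [ig int_eq] := scalar_measure_Rintegral (F_scalar h) nuF (mu_carried (L h))
    (@continuous_horner _ (Qpoly R n)).
  rewrite QE int_eq L_density mu_int moment_functional_mul_Qpoly; split=> //.
  by rewrite /= bop_iterE rmorph_nat.
by move=> x; rewrite /= bop_iterE rmorph_nat -(addrA (iter n N x)) -opprD [RHS]addrCA subrr addr0.
Qed.

End PowerRepresentation.

(** * Normal operators *)

Section GramOperator.
Variables (R : realType) (H : hilbertType R) (T : bop H).
Implicit Types (x y : H).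

Definition gram : bop H := bop_comp (adjoint T) T.

Lemma selfadjoint_gram : selfadjoint gram.
Proof. by apply: adjoint_unique => x y; rewrite /= inner_adjointl -inner_adjoint. Qed.

Lemma rdot_gram x : rdot (gram x) x = rdot (T x) (T x).
Proof. by rewrite /rdot /= inner_adjointl. Qed.

Lemma inner_iter_adjoint n x y : inner (iter n T x) y = inner x (iter n (adjoint T) y).
Proof. by elim: n x y => //= n IH x y; rewrite inner_adjoint IH -iterSr. Qed.

End GramOperator.

Section NormalOperators.
Variables (R : realType) (H : hilbertType R) (T : bop H).
Hypothesis T_normal : normal_op T.
Implicit Types (x h : H).

Lemma normal_op_adjoint : normal_op (adjoint T).
Proof. by move=> x; rewrite adjointK T_normal. Qed.

Lemma gram_adjoint : gram (adjoint T) =1 gram T.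
Proof. by move=> x; rewrite /= adjointK T_normal. Qed.

Lemma normal_iter_gram n x : iter n (adjoint T) (iter n T x) = iter n (gram T) x.
Proof.
have adjoint_comm m y : adjoint T (iter m (gram T) y) = iter m (gram T) (adjoint T y).
  by elim: m => //= m <-; rewrite T_normal.
by elim: n x => // n IH x; rewrite iterS iterSr IH adjoint_comm -iterSr.
Qed.

Lemma normal_cpd : cpd T.
Proof.
move=> h k lam _; pose N := gram T.
suff -> : \sum_(i < k.+1) \sum_(j < k.+1)
    (complex.Re (`|iter (i + j) T h| ^+ 2))%:C * lam i * Num.conj (lam j) =
  inner (\sum_(i < k.+1) lam i *: iter i N h) (\sum_(j < k.+1) lam j *: iter j N h).
  by rewrite inner_norm exprn_ge0.
rewrite inner_suml; apply: eq_bigr => i _; rewrite inner_sumr; apply: eq_bigr => j _.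
rewrite innerZl innerZr norm_rdot /= -norm_rdot -inner_norm inner_iter_adjoint.
rewrite normal_iter_gram iterD -(inner_selfadjoint_iter (selfadjoint_gram T)).
by ring.
Qed.

End NormalOperators.

Lemma normal_triplets (R : realType) (H : hilbertType R) (T : bop H) :
  normal_op T -> exists (B C : bop H) (F : set R -> bop H),
  representing_triplet T B C F /\ representing_triplet (adjoint T) B C F.
Proof.
move=> T_normal; have [K _ TK] := bop_rdot_bounded T; pose N := gram T.
have N_sa : selfadjoint N := selfadjoint_gram T.
have M_gt0 : 0 < K ^+ 2 + 1 by rewrite ltr_wpDl ?sqr_ge0.
have N_pos x : 0 <= rdot (N x) x by rewrite rdot_gram rdot_ge0.
have N_le x : rdot (N x) x <= (K ^+ 2 + 1) * rdot x x.
  by rewrite rdot_gram (le_trans (TK x))// ler_wpM2r ?rdot_ge0// lerDl.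
have [F [F_semi F_cpt F1 F_powers]] := power_representation N_sa M_gt0 N_pos N_le.
have triplet T' : normal_op T' -> gram T' =1 N ->
    representing_triplet T' (bop_sub N bop_id) bop_zero F.
  move=> T'_normal gramT'; split=> [||//|//|n].
  - by apply: selfadjoint_bop_sub => //; exact: selfadjoint_bop_id.
  - by move=> h; rewrite /= -(scale0r h) innerZl mul0r.
  - have [S S_int SE] := F_powers n; exists S => // x.
    by rewrite normal_iter_gram// (eq_iter gramT') SE scaler0 addr0.
exists (bop_sub N bop_id), bop_zero, F; split; apply: triplet => //.
- exact: normal_op_adjoint.
- exact: gram_adjoint.
Qed.

Theorem proposition3p2 (R : realType) (H : hilbertType R) (T : bop H) :
  normal_op T <->
  [/\ cpd T, cpd (adjoint T)
    & exists (B C : bop H) (F : set R -> bop H),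
        representing_triplet T B C F /\
        representing_triplet (adjoint T) B C F].
Proof.
split=> [T_normal|[_ _ [B [C [F [[_ _ [F_semi _] _ T_int] [_ _ _ _ T'_int]]]]]] x].
  by split; [exact: normal_cpd | exact/normal_cpd/normal_op_adjoint | exact: normal_triplets].
have [S S_int /(_ x)] := T_int 1; have [S' S'_int /(_ x)] := T'_int 1.
rewrite /= adjointK => -> ->; congr (_ + _); apply: quad_inj => h.
have [mu muF] := F_semi h.
by rewrite (S_int h mu muF).2 (S'_int h mu muF).2.
Qed.
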